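(* For every integer $k\ge 1$ the following identities of formal power series in $q$ hold (here $\sum_{n\neq 0}$ denotes a sum over all nonzero integers $n$): \begin{align*} \sum_{n=1}^\infty \mu2_{2k}(n) q^n &=\frac{(-q;q^2)_\infty}{(q^2;q^2)_\infty}\sum_{n\neq 0} \frac{(-1)^{n+1} q^{n(n+1)+2kn}}{(1-q^{2n})^{2k}} =\frac{(-q;q^2)_\infty}{(q^2;q^2)_\infty}\sum_{n\ge 1} \frac{(-1)^{n+1} q^{n(n-1)+2kn}(1+q^{2n})}{(1-q^{2n})^{2k}},\\ \sum_{n=1}^\infty \eta2_{2k}(n) q^n &=\frac{(-q;q^2)_\infty}{(q^2;q^2)_\infty}\sum_{n\neq 0} \frac{(-1)^{n+1} q^{n(2n+1)+2kn}}{(1-q^{2n})^{2k}} =\frac{(-q;q^2)_\infty}{(q^2;q^2)_\infty}\sum_{n\ge 1} \frac{(-1)^{n+1} q^{n(2n-1)+2kn}(1+q^{2n})}{(1-q^{2n})^{2k}},\\ \sum_{n=1}^\infty \overline{\mu}_{2k}(n) q^n &=\frac{(-q;q)_\infty}{(q;q)_\infty}\sum_{n\neq 0} \frac{(-1)^{n+1} q^{n(n+1)/2+kn}}{(1-q^n)^{2k}} =\frac{(-q;q)_\infty}{(q;q)_\infty}\sum_{n\ge 1} \frac{(-1)^{n+1} q^{n(n-1)/2+kn}(1+q^{n})}{(1-q^{n})^{2k}},\\ \sum_{n=1}^\infty \overline{\eta}_{2k}(n) q^n &=2\frac{(-q;q)_\infty}{(q;q)_\infty}\sum_{n\neq 0}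 \frac{(-1)^{n+1} q^{n^2+n+kn}}{(1+q^n)(1-q^n)^{2k}} =2\frac{(-q;q)_\infty}{(q;q)_\infty}\sum_{n\ge 1} \frac{(-1)^{n+1} q^{n^2+kn}}{(1-q^n)^{2k}},\\ \sum_{n=1}^\infty \overline{\mu2}_{2k}(n) q^n &=\frac{(-q;q)_\infty}{(q;q)_\infty}\sum_{n\neq 0} \frac{(-1)^{n+1} q^{n(n+1)+2kn}}{(1-q^{2n})^{2k}} =\frac{(-q;q)_\infty}{(q;q)_\infty}\sum_{n\ge 1} \frac{(-1)^{n+1} q^{n(n-1)+2kn}(1+q^{2n})}{(1-q^{2n})^{2k}},\\ \sum_{n=1}^\infty \overline{\eta2}_{2k}(n) q^n &=2\frac{(-q;q)_\infty}{(q;q)_\infty}\sum_{n\neq 0} \frac{(-1)^{n+1} q^{n^2+2n+2kn}}{(1+q^{2n})(1-q^{2n})^{2k}} =2\frac{(-q;q)_\infty}{(q;q)_\infty}\sum_{n\ge 1} \frac{(-1)^{n+1} q^{n^2+2kn}}{(1-q^{2n})^{2k}}. \end{align*}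
   Context: Notation: $(a;q)_n=\prod_{j=0}^{n-1}(1-aq^j)$, $(a;q)_\infty=\prod_{j\ge0}(1-aq^j)$, and $(a_1,\dots,a_r;q)_n=(a_1;q)_n\cdots(a_r;q)_n$. Define integers $N2(m,n)$, $M2(m,n)$, $\overline N(m,n)$, $\overline M(m,n)$, $\overline{N2}(m,n)$, $\overline{M2}(m,n)$ ($m\in\mathbb Z$, $n\ge 0$) as the coefficients of $z^mq^n$ in, respectively, $\sum_{n\ge0} \frac{q^{n^2}(-q;q^2)_n}{(zq^2;q^2)_n(z^{-1}q^2;q^2)_n}$; $\frac{(-q;q^2)_\infty(q^2;q^2)_\infty}{(zq^2;q^2)_\infty(z^{-1}q^2;q^2)_\infty}$; $\sum_{n\ge0}\frac{(-1;q)_n q^{n(n+1)/2}}{(zq;q)_n(z^{-1}q;q)_n}$; $\frac{(-q;q)_\infty(q;q)_\infty}{(zq;q)_\infty(z^{-1}q;q)_\infty}$; $\sum_{n\ge0}\frac{q^n(-1;q)_{2n}}{(zq^2;q^2)_n(z^{-1}q^2;q^2)_n}$; $\frac{(-q;q)_\infty(q^2;q^2)_\infty}{(q;q^2)_\infty(zq^2;q^2)_\infty(z^{-1}q^2;q^2)_\infty}$. (Combinatorially these count, respectively: partitions of $n$ without repeated odd parts by $M_2$-rank; such partitions by the crank of the halved even-part subpartition; overpartitions of $n$ by Dyson rank; overpartitions by the crank of the non-overlined subpartition; overpartitions by $M_2$-rank; overpartitions by the crank of the halved even non-overlined subpartition.) For each such $X(m,n)$ the symmetrized moments are $\sum_{m\in\mathbb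 Z}\binom{m+\lfloor (k-1)/2\rfloor}{k}X(m,n)$; these are denoted $\eta2_k(n)$ for $N2$, $\mu2_k(n)$ for $M2$, $\overline\eta_k(n)$ for $\overline N$, $\overline\mu_k(n)$ for $\overline M$, $\overline{\eta2}_k(n)$ for $\overline{N2}$, $\overline{\mu2}_k(n)$ for $\overline{M2}$. *)

(* Defs.v *)
From HB Require Import structures.
From mathcomp Require Import all_boot all_order all_algebra.
From mathcomp Require Import all_classical zify.

Set Implicit Arguments.
Unset Strict Implicit.
Unset Printing Implicit Defensive.

Import Order.TTheory GRing.Theory Num.Theory.

Local Open Scope classical_set_scope.
Local Open Scope ring_scope.

(* R((x)): formal Laurent series, i.e. coefficient functions [int -> R] that
   vanish below some index. *)

Definition lower_bounded (R : nmodType) : pred (int -> R) :=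
  fun f => `[< exists N : int, forall i : int, i < N -> f i = 0 >].

Record laurent (R : nmodType) := Laurent {
  coefl :> int -> R;
  coefl_lower_bounded : lower_bounded coefl }.

HB.instance Definition _ (R : nmodType) := [isSub for @coefl R].
HB.instance Definition _ (R : nmodType) := [Choice of laurent R by <:].

Lemma laurentP (R : nmodType) (a b : laurent R) :
  (forall i, a i = b i) -> a = b.
Proof. by move=> ab; apply/val_inj/funext. Qed.

Lemma laurent_bound (R : nmodType) (a : laurent R) :
  exists N : int, forall i : int, i < N -> a i = 0.
Proof. by case: a => f /= /asboolP. Qed.

Section Zmodule.
Variable R : zmodType.
Implicit Types a b c : laurent R.

Fact lzero_subproof : lower_bounded (fun _ : int => 0 : R).
Proof. by apply/asboolP; exists 0. Qed.
Definition lzero : laurent R := Laurent lzero_subproof.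

Fact lopp_subproof a : lower_bounded (fun i => - a i).
Proof.
apply/asboolP; have [N aN] := laurent_bound a.
by exists N => i /aN ->; rewrite oppr0.
Qed.
Definition lopp a : laurent R := Laurent (lopp_subproof a).

Fact ladd_subproof a b : lower_bounded (fun i => a i + b i).
Proof.
apply/asboolP; have [N aN] := laurent_bound a; have [M bM] := laurent_bound b.
exists (Num.min N M) => i; rewrite lt_min => /andP[/aN -> /bM ->].
exact: addr0.
Qed.
Definition ladd a b : laurent R := Laurent (ladd_subproof a b).

Fact laddA : associative ladd.
Proof. by move=> a b c; apply: laurentP => i /=; exact: addrA. Qed.
Fact laddC : commutative ladd.
Proof. by move=> a b; apply: laurentP => i /=; exact: addrC. Qed.
Fact ladd0 : left_id lzero ladd.
Proof. by move=> a; apply: laurentP => i /=; exact: add0r. Qed.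
Fact laddN : left_inverse lzero lopp ladd.
Proof. by move=> a; apply: laurentP => i /=; exact: addNr. Qed.

HB.instance Definition _ := GRing.isZmodule.Build (laurent R) laddA laddC ladd0 laddN.
End Zmodule.

Section Ring.
Variable R : comNzRingType.
Implicit Types a b c : laurent R.

Definition mono_fun (x : R) (d i : int) : R := if i == d then x else 0.

Fact mono_subproof x d : lower_bounded (mono_fun x d).
Proof.
by apply/asboolP; exists d => i; rewrite /mono_fun; case: eqP => // ->; rewrite ltxx.
Qed.
Definition lmono (x : R) (d : int) : laurent R := Laurent (mono_subproof x d).

Definition lconst (x : R) : laurent R := lmono x 0.
Definition lvar : laurent R := lmono 1 1.

(* The sum is finite because both supports are bounded below. *)
Definition lmul_fun a b (n : int) : R := \sum_(i \in [set: int]) a i * b (n - i).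

Let tr (N : int) (K : nat) a : {poly R} := \poly_(i < K) a (N + i%:Z).

Lemma lmul_funE a b (N M : int) (n : nat) :
  (forall i, i < N -> a i = 0) -> (forall i, i < M -> b i = 0) ->
  lmul_fun a b (N + M + n%:Z) =
  \sum_(i < n.+1) a (N + i%:Z) * b (M + (n - i)%N%:Z).
Proof.
move=> aN bM; rewrite /lmul_fun.
pose s := [seq N + i%:Z | i <- iota 0 n.+1].
have us : uniq s.
  by rewrite map_inj_uniq ?iota_uniq // => i j /addrI [].
transitivity (\sum_(i <- s) a i * b (N + M + n%:Z - i)).
  rewrite (fsbig_seq _ _ us) /=; symmetry; apply: fsbig_widen => // i [_ /=].
  move=> nis; have [/aN -> | Ni] := ltP i N; first by rewrite mul0r.
  have [/bM -> | Mi] := ltP (N + M + n%:Z - i) M; first by rewrite mulr0.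
  exfalso; apply: nis; rewrite /mkset; apply/mapP.
  have iN : (absz (i - N))%:Z = i - N by rewrite gez0_abs // subr_ge0.
  exists (absz (i - N)); last by rewrite iN addrCA subrr addr0.
  rewrite mem_iota add0n /= ltnS -lez_nat iN.
  lia.
rewrite big_map -[iota 0 n.+1]/(index_iota 0 n.+1) big_mkord.
apply: eq_bigr => i _; congr (_ * b _).
have := ltn_ord i; lia.
Qed.

Lemma lmul_fun_low a b (N M n : int) :
  (forall i, i < N -> a i = 0) -> (forall i, i < M -> b i = 0) ->
  n < N + M -> lmul_fun a b n = 0.
Proof.
move=> aN bM nNM; apply: fsbig1 => i _.
have [/aN -> | Ni] := ltP i N; first by rewrite mul0r.
rewrite bM ?mulr0 // ltrBlDr (lt_le_trans nNM) // addrC lerD2l //.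
Qed.

Fact lmul_subproof a b : lower_bounded (lmul_fun a b).
Proof.
apply/asboolP; have [N aN] := laurent_bound a; have [M bM] := laurent_bound b.
by exists (N + M) => i; exact: lmul_fun_low.
Qed.
Definition lmul a b : laurent R := Laurent (lmul_subproof a b).

Lemma lmul_tr a b (N M : int) (K n : nat) :
  (forall i, i < N -> a i = 0) -> (forall i, i < M -> b i = 0) ->
  (n < K)%N -> lmul a b (N + M + n%:Z) = (tr N K a * tr M K b)`_n.
Proof.
move=> aN bM nK; rewrite /= lmul_funE // coefM; apply: eq_bigr => i _.
by rewrite !coef_poly (leq_ltn_trans _ nK) ?(leq_ltn_trans _ nK) ?leq_subr // -ltnS.
Qed.

Lemma tr_lmul a b (N M : int) (K n : nat) :
  (forall i, i < N -> a i = 0) -> (forall i, i < M -> b i = 0) ->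
  (n < K)%N -> (tr (N + M) K (lmul a b))`_n = (tr N K a * tr M K b)`_n.
Proof. by move=> aN bM nK; rewrite coef_poly nK (lmul_tr aN bM nK). Qed.

Lemma int_above (N n : int) : N <= n -> exists k : nat, n = N + k%:Z.
Proof.
by move=> Nn; exists (absz (n - N)); rewrite gez0_abs ?subr_ge0 // addrCA subrr addr0.
Qed.

Fact lmulC : commutative lmul.
Proof.
move=> a b; apply: laurentP => n.
have [N aN] := laurent_bound a; have [M bM] := laurent_bound b.
have [nNM | /int_above[k ->]] := ltP n (N + M).
  by rewrite /= (lmul_fun_low aN bM) // (lmul_fun_low bM aN) // addrC.
by rewrite (lmul_tr aN bM (ltnSn k)) mulrC -(lmul_tr bM aN (ltnSn k)) [M + N]addrC.
Qed.

Fact lmulA : associative lmul.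
Proof.
move=> a b c; apply: laurentP => n.
have [N aN] := laurent_bound a; have [M bM] := laurent_bound b.
have [P cP] := laurent_bound c.
have abNM i : i < N + M -> lmul a b i = 0 by exact: lmul_fun_low.
have bcMP i : i < M + P -> lmul b c i = 0 by exact: lmul_fun_low.
have [nNMP | /int_above[k ->]] := ltP n (N + M + P).
  rewrite /= (lmul_fun_low abNM cP) //.
  by rewrite (lmul_fun_low aN bcMP) // addrA.
rewrite (lmul_tr abNM cP (ltnSn k)) -[N + M + P]addrA (lmul_tr aN bcMP (ltnSn k)).
transitivity ((tr N k.+1 a * (tr M k.+1 b * tr P k.+1 c))`_k).
  rewrite !coefM; apply: eq_bigr => i _.
  by rewrite tr_lmul // ltnS leq_subr.
rewrite mulrA !coefM; apply: eq_bigr => i _.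
by rewrite tr_lmul.
Qed.

Fact lmul1 : left_id (lconst 1) lmul.
Proof.
move=> a; apply: laurentP => n /=; rewrite /lmul_fun.
transitivity (\sum_(i \in [set 0 : int]) mono_fun 1 0 i * a (n - i)).
  symmetry; apply: fsbig_widen => // i [_ /= /eqP i0].
  by rewrite /mono_fun (negPf i0) mul0r.
by rewrite fsbig_set1 /mono_fun eqxx mul1r subr0.
Qed.

Fact lmulDl : left_distributive lmul (@ladd R).
Proof.
move=> a b c; apply: laurentP => n.
have [Na aN] := laurent_bound a; have [Nb bN] := laurent_bound b.
have [P cP] := laurent_bound c.
pose N := Num.min Na Nb.
have {}aN i : i < N -> a i = 0 by rewrite lt_min => /andP[/aN].
have {}bN i : i < N -> b i = 0 by rewrite lt_min => /andP[_ /bN].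
have abN i : i < N -> ladd a b i = 0 by move=> iN; rewrite /= aN ?bN ?addr0.
have [nNP | /int_above[k ->]] := ltP n (N + P).
  by rewrite /= (lmul_fun_low abN cP) // (lmul_fun_low aN cP) //
             (lmul_fun_low bN cP) // addr0.
rewrite /= (lmul_funE _ abN cP) (lmul_funE _ aN cP) (lmul_funE _ bN cP).
by rewrite -big_split; apply: eq_bigr => i _; rewrite mulrDl.
Qed.

Fact lone_neq0 : lconst 1 != 0.
Proof.
apply/eqP => /(congr1 (fun a : laurent R => a 0)) /=.
by rewrite /mono_fun eqxx => /eqP; rewrite oner_eq0.
Qed.

HB.instance Definition _ :=
  GRing.Zmodule_isComNzRing.Build (laurent R) lmulA lmulC lmul1 lmulDl lone_neq0.

(* As usual for unit rings, a non-invertible series is its own inverse; every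
   series inverted below is invertible. *)
Definition lunit : pred (laurent R) := fun a => `[< exists b, b * a = 1 >].
Definition linv a : laurent R :=
  if pselect (exists b, b * a = 1) is left e then projT1 (cid e) else a.

Fact lmulVr : {in lunit, left_inverse 1 linv *%R}.
Proof.
move=> a /asboolP ua; rewrite /linv; case: pselect => // e.
exact: (projT2 (cid e)).
Qed.
Fact lunitP a b : b * a = 1 -> lunit a.
Proof. by move=> ba; apply/asboolP; exists b. Qed.
Fact linv_out : {in [predC lunit], linv =1 id}.
Proof.
by move=> a; rewrite inE /= => /asboolP nua; rewrite /linv; case: pselect.
Qed.

HB.instance Definition _ :=
  GRing.ComNzRing_hasMulInverse.Build (laurent R) lmulVr lunitP linv_out.

Lemma lmonoM (x y : R) (d e : int) : lmono x d * lmono y e = lmono (x * y) (d + e).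
Proof.
apply: laurentP => n; rewrite /= /lmul_fun.
transitivity (\sum_(i \in [set d]) mono_fun x d i * mono_fun y e (n - i)).
  symmetry; apply: fsbig_widen => // i [_ /= /eqP id].
  by rewrite /mono_fun (negPf id) mul0r.
rewrite fsbig_set1 /mono_fun eqxx subr_eq [e + d]addrC.
by case: eqP => // _; rewrite mulr0.
Qed.

Lemma lvar_unit : lvar \is a GRing.unit.
Proof. by apply: (@lunitP _ (lmono 1 (- 1))); rewrite lmonoM mulr1 addNr. Qed.

End Ring.

Arguments lvar {R}.
Arguments lconst {R}.

Section Limits.
Variable R : comNzRingType.

(* Convergence is coefficientwise: a family is summable when each power of the
   variable occurs in finitely many terms, and a product converges when each
   coefficient of the partial products is eventually constant. Divergent sums
   and products are given the value 0. *)
Definition is_lsum (I : choiceType) (A : set I) (t : I -> laurent R)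
    (S : laurent R) : Prop :=
  forall d : int, finite_set [set i | A i /\ t i d != 0] /\
                  S d = \sum_(i \in A) t i d.

Definition lsum (I : choiceType) (A : set I) (t : I -> laurent R) : laurent R :=
  xget 0 [set S | is_lsum A t S].

Lemma lsumE (I : choiceType) (A : set I) (t : I -> laurent R) S :
  is_lsum A t S -> lsum A t = S.
Proof.
move=> tS; rewrite /lsum; case: xgetP => [T _ tT | /(_ S)//].
by apply: laurentP => d; have [_ ->] := tT d; have [_ ->] := tS d.
Qed.

Definition is_lprod (f : nat -> laurent R) (P : laurent R) : Prop :=
  forall d : int, exists N : nat, forall n : nat, (N <= n)%N ->
    (\prod_(j < n) f j) d = P d.

Definition lprod (f : nat -> laurent R) : laurent R :=
  xget 0 [set P | is_lprod f P].

Lemma lprodE (f : nat -> laurent R) P : is_lprod f P -> lprod f = P.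
Proof.
move=> fP; rewrite /lprod; case: xgetP => [Q _ fQ | /(_ P)//].
apply: laurentP => d; have [N NQ] := fQ d; have [M MP] := fP d.
by rewrite -(NQ (maxn N M)) ?leq_maxl // MP ?leq_maxr.
Qed.

Definition qpoch (a q : laurent R) (n : nat) : laurent R :=
  \prod_(j < n) (1 - a * q ^+ j).

Definition qpoch_inf (a q : laurent R) : laurent R :=
  lprod (fun j => 1 - a * q ^+ j).

End Limits.

(* The two-variable generating functions live in Z[z,1/z][[q]], which is
   viewed inside Z((z))((q)): the outer variable is q, so that for instance
   1/(1 - q/z) expands as the sum of the q^j/z^j. *)
Local Notation ser2 := (laurent (laurent int)).
Definition q2 : ser2 := lvar.
Definition z2 : ser2 := lconst lvar.

Definition coef_zq (F : ser2) (m : int) (n : nat) : int := F n%:Z m.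

Definition N2_gf : ser2 :=
  lsum [set: nat] (fun n => q2 ^+ (n ^ 2) * qpoch (- q2) (q2 ^+ 2) n /
    (qpoch (z2 * q2 ^+ 2) (q2 ^+ 2) n * qpoch (z2^-1 * q2 ^+ 2) (q2 ^+ 2) n)).

Definition M2_gf : ser2 :=
  qpoch_inf (- q2) (q2 ^+ 2) * qpoch_inf (q2 ^+ 2) (q2 ^+ 2) /
  (qpoch_inf (z2 * q2 ^+ 2) (q2 ^+ 2) * qpoch_inf (z2^-1 * q2 ^+ 2) (q2 ^+ 2)).

Definition Nbar_gf : ser2 :=
  lsum [set: nat] (fun n => qpoch (- 1) q2 n * q2 ^+ ((n * n.+1) %/ 2) /
    (qpoch (z2 * q2) q2 n * qpoch (z2^-1 * q2) q2 n)).

Definition Mbar_gf : ser2 :=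
  qpoch_inf (- q2) q2 * qpoch_inf q2 q2 /
  (qpoch_inf (z2 * q2) q2 * qpoch_inf (z2^-1 * q2) q2).

Definition N2bar_gf : ser2 :=
  lsum [set: nat] (fun n => q2 ^+ n * qpoch (- 1) q2 (2 * n) /
    (qpoch (z2 * q2 ^+ 2) (q2 ^+ 2) n * qpoch (z2^-1 * q2 ^+ 2) (q2 ^+ 2) n)).

Definition M2bar_gf : ser2 :=
  qpoch_inf (- q2) q2 * qpoch_inf (q2 ^+ 2) (q2 ^+ 2) /
  (qpoch_inf q2 (q2 ^+ 2) *
   qpoch_inf (z2 * q2 ^+ 2) (q2 ^+ 2) * qpoch_inf (z2^-1 * q2 ^+ 2) (q2 ^+ 2)).

Definition N2 := coef_zq N2_gf.
Definition M2 := coef_zq M2_gf.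
Definition Nbar := coef_zq Nbar_gf.
Definition Mbar := coef_zq Mbar_gf.
Definition N2bar := coef_zq N2bar_gf.
Definition M2bar := coef_zq M2bar_gf.

(* x (x-1) ... (x-k+1) / k! for an integer x; the division is exact. *)
Definition binz (x : int) (k : nat) : int :=
  ((\prod_(j < k) (x - j%:Z)) %/ k`!%:Z)%Z.

(* [%/] is the floor; for each n only finitely many X m n are nonzero in the
   cases of interest. *)
Definition sym_moment (X : int -> nat -> int) (k n : nat) : int :=
  \sum_(m \in [set: int]) binz (m + ((k%:Z - 1) %/ 2)%Z) k * X m n.

Definition eta2 := sym_moment N2.
Definition mu2 := sym_moment M2.
Definition eta_bar := sym_moment Nbar.
Definition mu_bar := sym_moment Mbar.
Definition eta2_bar := sym_moment N2bar.
Definition mu2_bar := sym_moment M2bar.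

Local Notation ser := (laurent int).
Definition q1 : ser := lvar.

Definition gf_pos (f : nat -> int) : ser :=
  lsum [set n : nat | (1 <= n)%N] (fun n => (f n)%:~R * q1 ^+ n).

Definition sum_nonzero (t : int -> ser) : ser := lsum [set n : int | n != 0] t.
Definition sum_pos (t : nat -> ser) : ser := lsum [set n : nat | (1 <= n)%N] t.

(* Main.v *)
From HB Require Import structures.
Require Import Defs.
From mathcomp Require Import all_boot all_order all_algebra.
From mathcomp Require Import all_classical.
From mathcomp Require Import zify ring.
Set Implicit Arguments.
Unset Strict Implicit.
Unset Printing Implicit Defensive.
Import Order.TTheory GRing.Theory Num.Theory.
Local Open Scope classical_set_scope.
Local Open Scope ring_scope.

(* With Q = q or q^2, the crank and rank generating functions all have the form
   sum_n delta_n / ((zQ;Q)_n (Q/z;Q)_n), or are limits of such terms.  The partial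
   fraction expansion of 1 / ((zQ;Q)_n (Q/z;Q)_n) in z is a Bailey pair relative to 1,
   and the q-Pfaff-Saalschuetz sum evaluates the resulting coefficients in finite form;
   letting the truncation go to infinity (Tannery) gives
     F(z) = P (1 + sum_{r >= 1} c_r (1 - z)(1 - 1/z) / ((1 - z Q^r)(1 - Q^r/z))).
   The symmetrized moment is the coefficientwise linear functional z^m |-> w_k(m) with
   w_k(m) = binomial (m + k - 1) (2k), whose second difference in m is w_(k-1).  Together
   with (1 - zy)(1 - y/z) = (1 - y)^2 + y (1 - z)(1 - 1/z), this forces its value on the
   r-th partial fraction to be - y^(k-1) / (1 - y)^(2k), where y = Q^r. *)

(** * The q-adic topology on Laurent series *)

(** The functional z^m |-> w_k(m) behaves linearly only on coefficients with finite support in z,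
    while elements of Z((z)) have supports bounded on one side only. It is therefore applied to
    truncated sums, one partial fraction at a time, and limits are taken afterwards in Z((q)).

    At level N put gamma_(N,r) = sum over n >= r of delta_(N,n) / ((Q;Q)_(n-r) (Q;Q)_(n+r));
    exchanging sums turns the truncated series into sum_r gamma_(N,r) alpha_r. For cranks
    delta_(N,n) is concentrated at n = N. For ranks it is the weight of Bailey's lemma with (rho_1,
    rho_2) equal to (infinity, -q) and Q = q^2 for [N2], (infinity, -1) and Q = q for [Nbar], (-1,
    -q) and Q = q^2 for [N2bar].

    The factor 1 + Q^r of alpha_r joins the indices r and -r. It survives for the cranks and for
    [N2]; a parameter rho = -1 yields (-1;Q)_r / (-Q;Q)_r = 2 / (1 + Q^r), which cancels it and
    accounts for the 2 in the other two rank identities. The term r = 0 disappears because w_k(0) =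
    0 for k >= 1. *)

Section Adic.
Variable R : comNzRingType.
Implicit Types (a b c x F G : laurent R) (f g : nat -> laurent R) (N n : nat).

(* [vge N F]: F has valuation at least N, that is, F = O(q^N). *)
Definition vge N F := forall i : int, i < N%:Z -> F i = 0.

Lemma vge0 N : vge N 0. Proof. by []. Qed.
Lemma vgeD N F G : vge N F -> vge N G -> vge N (F + G).
Proof. by move=> vF vG i iN; rewrite /= vF // vG // addr0. Qed.
Lemma vgeN N F : vge N F -> vge N (- F).
Proof. by move=> vF i iN; rewrite /= vF // oppr0. Qed.
Lemma vgeB N F G : vge N F -> vge N G -> vge N (F - G).
Proof. by move=> vF vG; apply/vgeD/vgeN. Qed.
Lemma vgeM N n F G : vge N F -> vge n G -> vge (N + n) (F * G).
Proof. by move=> vF vG i iN; apply: (lmul_fun_low vF vG); rewrite -PoszD. Qed.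
Lemma vgeW N n F : (n <= N)%N -> vge N F -> vge n F.
Proof. by move=> nN vF i iN; apply: vF; lia. Qed.
Lemma vgeMl N F G : vge 0 F -> vge N G -> vge N (F * G).
Proof. by move=> vF vG; apply: (vgeM vF vG). Qed.
Lemma vgeMr N F G : vge N F -> vge 0 G -> vge N (F * G).
Proof. by move=> vF vG; rewrite mulrC; apply: vgeMl. Qed.
Lemma vge1 : vge 0 1.
Proof. by move=> i i0; rewrite /= /mono_fun; case: eqP => // i00; rewrite i00 in i0. Qed.
Lemma vgeX N F n : vge N F -> vge (N * n) (F ^+ n).
Proof.
move=> vF; elim: n => [|n IH]; first by rewrite muln0; apply: vge1.
by rewrite exprS mulnS; apply: vgeM.
Qed.
Lemma vge0X n F : vge 0 F -> vge 0 (F ^+ n).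
Proof. by move=> /(@vgeX 0 F n). Qed.
Lemma vge_sum N (I : Type) (r : seq I) (P : pred I) (t : I -> laurent R) :
  (forall i, P i -> vge N (t i)) -> vge N (\sum_(i <- r | P i) t i).
Proof. by move=> vt; apply: big_ind => [|F G|]; [exact: vge0 | exact: vgeD | exact: vt]. Qed.
Lemma vge_prod (I : Type) (r : seq I) (P : pred I) (t : I -> laurent R) :
  (forall i, P i -> vge 0 (t i)) -> vge 0 (\prod_(i <- r | P i) t i).
Proof. by move=> vt; apply: big_ind => [|F G|]; [exact: vge1 | exact: vgeMl | exact: vt]. Qed.
Lemma vge_lvar : vge 1 (lvar : laurent R).
Proof. by move=> i i1; rewrite /= /mono_fun; case: eqP => // e; rewrite e in i1. Qed.
Lemma vge_lconst (u : R) : vge 0 (lconst u).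
Proof. by move=> i i1; rewrite /= /mono_fun; case: eqP => // e; rewrite e in i1. Qed.

(** Convergence in the q-adic topology, uniform over all coefficients below q^N; [is_lsum] and
    [is_lprod] fix one coefficient at a time and are reached from it through [is_lsum_series] and
    [qpoch_lcvg]. *)
Definition lcvg f F := forall N, exists n0, forall n, (n0 <= n)%N -> vge N (f n - F).

Lemma eq_lcvg f g F : f =1 g -> lcvg f F -> lcvg g F.
Proof. by move=> fg cf N; have [n0 h] := cf N; exists n0 => n; rewrite -fg; apply: h. Qed.
Lemma lcvg_cst F : lcvg (fun=> F) F.
Proof. by move=> N; exists 0 => n _; rewrite subrr; apply: vge0. Qed.
Lemma vge_eq0 F : (forall N, vge N F) -> F = 0.
Proof. by move=> vF; apply: laurentP => i; apply: (vF (absz i).+1); lia. Qed.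
Lemma lcvg_unique f F G : lcvg f F -> lcvg f G -> F = G.
Proof.
move=> cF cG; apply/eqP; rewrite -subr_eq0; apply/eqP/vge_eq0 => N.
have [n0 h0] := cF N; have [n1 h1] := cG N; pose n := maxn n0 n1.
have -> : F - G = (f n - G) - (f n - F) by ring.
by apply: vgeB; [apply: h1; rewrite leq_maxr | apply: h0; rewrite leq_maxl].
Qed.
Lemma lcvgD f g F G : lcvg f F -> lcvg g G -> lcvg (fun n => f n + g n) (F + G).
Proof.
move=> cF cG N; have [n0 h0] := cF N; have [n1 h1] := cG N.
exists (maxn n0 n1) => n; rewrite geq_max => /andP[/h0 v0 /h1 v1].
have -> : f n + g n - (F + G) = (f n - F) + (g n - G) by ring.
exact: vgeD.
Qed.
Lemma lcvg_sum m (t : nat -> nat -> laurent R) (T : nat -> laurent R) :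
  (forall i, lcvg (fun n => t n i) (T i)) ->
  lcvg (fun n => \sum_(i < m) t n i) (\sum_(i < m) T i).
Proof.
move=> ct; elim: m => [|m IH].
  by rewrite big_ord0; apply: eq_lcvg (lcvg_cst 0) => n; rewrite big_ord0.
rewrite big_ord_recr; apply: eq_lcvg (lcvgD IH (ct m)) => n.
by rewrite big_ord_recr.
Qed.
Lemma lcvg_vge N f F : (forall n, vge N (f n)) -> lcvg f F -> vge N F.
Proof.
move=> vf cf; have [n0 /(_ _ (leqnn _)) h] := cf N.
have -> : F = f n0 - (f n0 - F) by ring.
exact: vgeB.
Qed.
Lemma lcvgM f g F G : (forall n, vge 0 (f n)) -> (forall n, vge 0 (g n)) ->
  lcvg f F -> lcvg g G -> lcvg (fun n => f n * g n) (F * G).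
Proof.
move=> vf vg cF cG N; have [n0 h0] := cF N; have [n1 h1] := cG N.
exists (maxn n0 n1) => n; rewrite geq_max => /andP[/h0 v0 /h1 v1].
have -> : f n * g n - F * G = f n * (g n - G) + (f n - F) * G by ring.
by apply: vgeD; [apply: vgeMl | apply: vgeMr] => //; apply: lcvg_vge cG.
Qed.
Lemma lcvgMl F g G : vge 0 F -> (forall n, vge 0 (g n)) -> lcvg g G ->
  lcvg (fun n => F * g n) (F * G).
Proof. by move=> vF vg; apply: lcvgM => //; apply: lcvg_cst. Qed.
Lemma lcvg_comp f F (h : nat -> nat) : (forall n, exists m0, forall m, (m0 <= m)%N -> (n <= h m)%N) ->
  lcvg f F -> lcvg (f \o h) F.
Proof.
move=> hh cf N; have [n0 h0] := cf N; have [m0 hm] := hh n0.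
by exists m0 => m /hm; apply: h0.
Qed.

Lemma cauchy_lcvg f : (forall n, vge n (f n.+1 - f n)) -> vge 0 (f 0%N) ->
  exists F, lcvg f F.
Proof.
move=> cf v0.
have step m n : vge n (f (n + m)%N - f n).
  elim: m => [|m IH]; first by rewrite addn0 subrr; apply: vge0.
  rewrite addnS; have -> : f (n + m).+1 - f n = (f (n + m).+1 - f (n + m)%N) + (f (n + m)%N - f n) by ring.
  by apply: vgeD => //; apply: vgeW (cf _); rewrite leq_addr.
have vf n : vge 0 (f n).
  by rewrite -(subrK (f 0%N) (f n)); apply: vgeD => //; apply: (step n 0%N).
(* The coefficient of index i no longer changes from the term [(absz i).+1] on, so the limit is read
   off there. *)
pose F0 (i : int) : R := f (absz i).+1 i.
have lb : lower_bounded F0.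
  by apply/asboolP; exists 0 => i i0; rewrite /F0 vf.
exists (Laurent lb) => N; exists N => n Nn i iN /=; rewrite /F0.
have [i0|i0] := ltP i 0; first by rewrite !vf // subrr.
have /(_ i) : vge (absz i).+1 (f n - f (absz i).+1).
  have -> : n = ((absz i).+1 + (n - (absz i).+1))%N by lia.
  exact: step.
by rewrite /= => -> //; lia.
Qed.

(** The bound [vge n (t n)] leaves finitely many terms at each power of q, and vanishing outside A
    lets the sum over A be compared with initial segments of the naturals. *)
Lemma is_lsum_series (t : nat -> laurent R) (A : set nat) F : (forall n, vge n (t n)) ->
  (forall n, ~ A n -> t n = 0) ->
  lcvg (fun n => \sum_(i < n) t i) F -> is_lsum A t F.
Proof.
move=> vt At cF d; pose m := (absz d).+1.
have z i : (m <= i)%N -> t i d = 0 by move=> mi; apply: vt; rewrite /m in mi; lia.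
split.
  apply: (@sub_finite_set _ _ `I_m); last exact: finite_II.
  by move=> i [_ /=]; rewrite ltnNge; apply: contra => /z ->.
have -> : F d = (\sum_(i < m) t i) d.
  have [n0 h] := cF m; pose n := (maxn n0 m).
  have vFn := h n (leq_maxl _ _).
  have e : F - \sum_(i < m) t i = \sum_(m <= i < n) t i - (\sum_(i < n) t i - F).
    by rewrite -!(big_mkord xpredT) (@big_cat_nat _ _ _ m 0 n) ?leq_maxr //=; ring.
  apply/eqP; rewrite -subr_eq0.
  rewrite -[_ - _]/((F - \sum_(i < m) t i) d) e.
  apply/eqP; apply: (@vgeB m) => //; last by rewrite /m; lia.
  by rewrite big_nat; apply: vge_sum => i /andP[mi _]; apply: vgeW (vt i).
rewrite -(big_mkord xpredT t).
have -> : forall s : seq nat, (\sum_(i <- s) t i) d = \sum_(i <- s) t i d.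
  by elim=> [|i s IH]; rewrite ?big_nil ?big_cons //= -IH.
rewrite (fsbig_widen A setT) //; last by move=> i [_ /= /At ->].
rewrite -(fsbig_widen `I_m setT) //; last by move=> i [_ /=] /negP; rewrite -leqNgt => /z.
by rewrite -fsbig_ord big_mkord.
Qed.

Lemma series_lcvg (t : nat -> laurent R) : (forall n, vge n (t n)) ->
  exists F, lcvg (fun n => \sum_(i < n) t i) F.
Proof.
move=> vt; apply: cauchy_lcvg => [n|]; last by rewrite big_ord0; apply: vge0.
by rewrite big_ord_recr /= addrAC subrr add0r.
Qed.

Lemma lsum_lcvg (t : nat -> laurent R) (A : set nat) : (forall n, vge n (t n)) ->
  (forall n, ~ A n -> t n = 0) ->
  lcvg (fun n => \sum_(i < n) t i) (lsum A t).
Proof.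
move=> vt At; have [F cF] := series_lcvg vt.
by rewrite (lsumE (is_lsum_series vt At cF)).
Qed.

(** The bound [vge i (t n i)] is uniform in n: columns beyond N contribute O(q^N) in every row, and
    only finitely many columns remain to converge. *)
Lemma tannery (t : nat -> nat -> laurent R) (T : nat -> laurent R) F :
  (forall n i, (i <= n)%N -> vge i (t n i)) -> (forall i, lcvg (fun n => t n i) (T i)) ->
  lcvg (fun n => \sum_(i < n) T i) F ->
  lcvg (fun n => \sum_(i < n.+1) t n i) F.
Proof.
move=> vt ct cT N; have [n0 h0] := cT N.
have [n1 h1] := lcvg_sum (maxn n0 N) ct N.
exists (maxn n0 (maxn N n1)) => n; rewrite !geq_max => /and3P[n0n Nn n1n].
have /(_ (leq_maxl _ _)) v0 := h0 (maxn n0 N).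
have v1 := h1 n n1n.
have -> : \sum_(i < n.+1) t n i - F = (\sum_(i < maxn n0 N) t n i - \sum_(i < maxn n0 N) T i) +
  (\sum_(i < maxn n0 N) T i - F) + \sum_(maxn n0 N <= i < n.+1) t n i.
  rewrite -!(big_mkord xpredT) (@big_cat_nat _ _ _ (maxn n0 N) 0 n.+1) //=; first ring.
  by rewrite geq_max !leqW.
apply: vgeD; first exact: vgeD.
rewrite big_nat; apply: vge_sum => i /andP[mi ni]; apply: (@vgeW i); last exact: vt.
exact: leq_trans (leq_maxr _ _) mi.
Qed.

Lemma eq_is_lsum (I : choiceType) (A : set I) (t t' : I -> laurent R) :
  (forall i, A i -> t i = t' i) -> is_lsum A t = is_lsum A t'.
Proof.
move=> tt; apply/funext => S; apply/propext.
have E d : [set i | A i /\ t i d != 0] = [set i | A i /\ t' i d != 0].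
  by apply/seteqP; split=> i [Ai]; rewrite ?(tt _ Ai) // -?(tt _ Ai).
have E' d : \sum_(i \in A) t i d = \sum_(i \in A) t' i d.
  by apply: eq_fsbigr => i; rewrite inE => /tt ->.
by split=> h d; [rewrite -E -E' | rewrite E E']; apply: h.
Qed.

Lemma eq_lsum (I : choiceType) (A : set I) (t t' : I -> laurent R) :
  (forall i, A i -> t i = t' i) -> lsum A t = lsum A t'.
Proof. by move=> tt; rewrite /lsum (eq_is_lsum tt). Qed.

Lemma lsumP (t : nat -> laurent R) (A : set nat) :
  (forall n, A n -> vge n (t n)) -> is_lsum A t (lsum A t).
Proof.
(* Nothing is known about [t] outside A; extending by zero there makes the valuation bound hold at
   every index. *)
move=> vt; pose t' n := if pselect (A n) then t n else 0.
have tt n : A n -> t n = t' n by rewrite /t'; case: pselect.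
have vt' n : vge n (t' n) by rewrite /t'; case: pselect => // An; exact: vt.
have At' n : ~ A n -> t' n = 0 by rewrite /t'; case: pselect.
rewrite (eq_lsum tt) (eq_is_lsum tt); apply: is_lsum_series => //; exact: lsum_lcvg.
Qed.

Lemma lsumMl (t : nat -> laurent R) (A : set nat) c : vge 0 c ->
  (forall n, A n -> vge n (t n)) -> c * lsum A t = lsum A (fun n => c * t n).
Proof.
move=> vc vt; pose t' n := if pselect (A n) then t n else 0.
have tt n : A n -> t n = t' n by rewrite /t'; case: pselect.
have vt' n : vge n (t' n) by rewrite /t'; case: pselect => // An; exact: vt.
have At' n : ~ A n -> t' n = 0 by rewrite /t'; case: pselect.
rewrite (eq_lsum tt); have ct := lsum_lcvg vt' At'.
rewrite (@eq_lsum _ A (fun n => c * t n) (fun n => c * t' n)); last by move=> n /tt ->.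
apply/esym/lsumE/is_lsum_series => [n|n /At' ->|]; first exact: vgeMl.
  by rewrite mulr0.
apply: eq_lcvg (lcvgMl vc _ ct) => n; first by rewrite mulr_sumr.
by apply: vge_sum => i _; apply: vgeW (vt' i).
Qed.

(** The inverse is the limit of the geometric series in x. *)
Lemma unit_1B x : vge 1 x -> 1 - x \is a GRing.unit /\ vge 0 (1 - x)^-1.
Proof.
move=> vx.
have vX n : vge n (x ^+ n) by rewrite -[n in vge n]mul1n; apply: vgeX.
have [F cF] := series_lcvg vX.
have vs n : vge 0 (\sum_(i < n) x ^+ i) by apply: vge_sum => i _; apply: vgeW (vX i).
have v1 : vge 0 (1 - x) by apply: vgeB; [exact: vge1 | apply: vgeW vx].
have e : (1 - x) * F = 1.
  apply: lcvg_unique (lcvgMl v1 vs cF) _ => N; exists N => n Nn.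
  have -> : (1 - x) * (\sum_(i < n) x ^+ i) - 1 = - x ^+ n.
    by rewrite -[1 - x]opprB mulNr -subrX1; ring.
  by apply/vgeN/(vgeW Nn).
have u : 1 - x \is a GRing.unit by apply/unitrP; exists F; rewrite mulrC.
split=> //; have -> : (1 - x)^-1 = F by rewrite -[LHS]mulr1 -[X in _ * X]e mulKr.
exact: lcvg_vge vs cF.
Qed.

(** * Finite and infinite q-shifted factorials *)

Lemma vge_pow a (q : laurent R) j : vge 1 a -> vge 1 q -> vge j.+1 (a * q ^+ j).
Proof.
by move=> va vq; rewrite -add1n; apply: vgeM => //; rewrite -[j in vge j]mul1n; apply: vgeX.
Qed.

Lemma vge_qpoch a (q : laurent R) n : vge 0 a -> vge 0 q -> vge 0 (qpoch a q n).
Proof.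
move=> va vq; apply: vge_prod => i _; apply: vgeB; first exact: vge1.
by apply: vgeMl => //; apply: vge0X.
Qed.

Lemma qpochS a (q : laurent R) n : qpoch a q n.+1 = qpoch a q n * (1 - a * q ^+ n).
Proof. by rewrite /qpoch big_ord_recr. Qed.

Lemma qpoch0 a (q : laurent R) : qpoch a q 0 = 1.
Proof. by rewrite /qpoch big_ord0. Qed.

Lemma qpoch_unit a (q : laurent R) n : vge 1 a -> vge 1 q ->
  qpoch a q n \is a GRing.unit.
Proof.
move=> va vq; elim: n => [|n IH]; first by rewrite qpoch0 unitr1.
have v : vge 1 (a * q ^+ n) by exact: (vgeW (ltn0Sn _) (vge_pow va vq)).
by rewrite qpochS unitrM IH (unit_1B v).1.
Qed.

Lemma vge_qpochV a (q : laurent R) n : vge 1 a -> vge 1 q -> vge 0 (qpoch a q n)^-1.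
Proof.
move=> va vq; elim: n => [|n IH]; first by rewrite qpoch0 invr1; apply: vge1.
have v : vge 1 (a * q ^+ n) by exact: (vgeW (ltn0Sn _) (vge_pow va vq)).
rewrite qpochS invrM ?qpoch_unit //; last exact: (unit_1B v).1.
by apply: vgeMl => //; exact: (unit_1B v).2.
Qed.

Lemma qpoch_lcvg a (q : laurent R) : vge 1 a -> vge 1 q ->
  lcvg (qpoch a q) (qpoch_inf a q).
Proof.
move=> va vq; have v0a := vgeW (leqnSn 0) va; have v0q := vgeW (leqnSn 0) vq.
have [||F cF] := @cauchy_lcvg (qpoch a q).
- move=> n; rewrite qpochS mulrBr mulr1 addrAC subrr add0r; apply: vgeN.
  by apply: vgeMl; [exact: vge_qpoch | exact: (vgeW (leqnSn _) (vge_pow va vq))].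
- exact: vge_qpoch.
suff <- : F = qpoch_inf a q by [].
apply/esym/lprodE => d; have [n0 h] := cF (absz d).+1; exists n0 => n /h v.
by apply/eqP; rewrite -subr_eq0; apply/eqP; apply: v; lia.
Qed.

(** The inverses of the partial products form a Cauchy sequence, since 1/(1 - x) - 1 = x/(1 - x);
    their limit inverts [qpoch_inf a q] by continuity of the product. *)
Lemma qpochV_lcvg a (q : laurent R) : vge 1 a -> vge 1 q ->
  qpoch_inf a q \is a GRing.unit /\
  lcvg (fun n => (qpoch a q n)^-1) (qpoch_inf a q)^-1.
Proof.
move=> va vq; have v0a := vgeW (leqnSn 0) va; have v0q := vgeW (leqnSn 0) vq.
have u n : 1 - a * q ^+ n \is a GRing.unit.
  have v : vge 1 (a * q ^+ n) by exact: (vgeW (ltn0Sn _) (vge_pow va vq)).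
  exact: (unit_1B v).1.
have vV n : vge 0 (qpoch a q n)^-1 := vge_qpochV n va vq.
have [||F cF] := @cauchy_lcvg (fun n => (qpoch a q n)^-1).
- move=> n.
  have -> : (qpoch a q n.+1)^-1 - (qpoch a q n)^-1 = (qpoch a q n.+1)^-1 * (a * q ^+ n).
    rewrite qpochS invrM ?qpoch_unit // -[X in _ - X]mul1r -[X in _ - X * _](mulVr (u n)).
    by set w := (1 - _)^-1; set A := (qpoch _ _ _)^-1; set x := a * _; ring.
  by apply: vgeMl => //; exact: (vgeW (leqnSn _) (vge_pow va vq)).
- by rewrite qpoch0 invr1; apply: vge1.
have e : qpoch_inf a q * F = 1.
  apply: lcvg_unique (lcvgM _ vV (qpoch_lcvg va vq) cF) _ => [n|]; first exact: vge_qpoch.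
  by apply: eq_lcvg (lcvg_cst 1) => n; rewrite divrr ?qpoch_unit.
have ui : qpoch_inf a q \is a GRing.unit by apply/unitrP; exists F; rewrite mulrC.
split=> //; suff -> : (qpoch_inf a q)^-1 = F by [].
by rewrite -[LHS]mulr1 -e mulKr.
Qed.

Lemma vge_qpoch_inf a (q : laurent R) : vge 1 a -> vge 1 q -> vge 0 (qpoch_inf a q).
Proof.
move=> va vq; apply: lcvg_vge (qpoch_lcvg va vq) => n.
by apply: vge_qpoch; [apply: vgeW va | apply: vgeW vq].
Qed.

Lemma vge_qpoch_infV a (q : laurent R) : vge 1 a -> vge 1 q -> vge 0 (qpoch_inf a q)^-1.
Proof.
by move=> va vq; apply: lcvg_vge (qpochV_lcvg va vq).2 => n; apply: vge_qpochV.
Qed.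

Lemma qpoch_split a (q : laurent R) n :
  qpoch a q (2 * n) = qpoch a (q ^+ 2) n * qpoch (a * q) (q ^+ 2) n.
Proof.
elim: n => [|n IH]; first by rewrite !qpoch0 mulr1.
by rewrite mulnS !qpochS IH -!exprM (exprS q (2 * n)%N); ring.
Qed.

(** The partial products of even length split by [qpoch_split] and form a subsequence of those
    defining the left-hand side. *)
Lemma qpoch_inf_split a (q : laurent R) : vge 1 a -> vge 1 q ->
  qpoch_inf a q = qpoch_inf a (q ^+ 2) * qpoch_inf (a * q) (q ^+ 2).
Proof.
move=> va vq; have v0a := vgeW (leqnSn 0) va; have v0q := vgeW (leqnSn 0) vq.
have vq2 : vge 1 (q ^+ 2) by apply: vgeW (@vgeX 1 q 2 vq).
have vaq : vge 1 (a * q) by apply: vgeMr.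
have v0q2 := vge0X 2 v0q.
apply: (@lcvg_unique (qpoch a q \o muln 2)).
  by apply: lcvg_comp (qpoch_lcvg va vq) => n; exists n => m; lia.
apply: eq_lcvg (lcvgM _ _ (qpoch_lcvg va vq2) (qpoch_lcvg vaq vq2)) => n /=.
- by rewrite qpoch_split.
- exact: vge_qpoch.
- by apply: vge_qpoch => //; apply: vgeMl.
Qed.

End Adic.

(** * Bailey pair and finite Bailey lemma *)

Section BaileyPair.
Variables (R : comNzRingType) (Q : laurent R).
Hypothesis vQ : vge 1 Q.
Implicit Types (n r m N M : nat) (a b : laurent R).

Definition iq n : laurent R := (qpoch Q Q n)^-1.

(** Expressing a reciprocal through the next one reduces all those in a telescoping identity to a
    few of highest index, after which [ring] works without division. *)
Lemma iqS n : iq n = (1 - Q ^+ n.+1) * iq n.+1.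
Proof.
rewrite exprS.
have v : vge 1 (Q * Q ^+ n) by exact: (vgeW (ltn0Sn _) (vge_pow vQ vQ)).
have u := (unit_1B v).1.
by rewrite /iq qpochS invrM ?qpoch_unit // mulVKr.
Qed.

Section Pair.
Variables z w : laurent R.
Hypotheses (zw : z * w = 1) (vz : vge 0 z) (vw : vge 0 w).

Definition bailey_beta n := (qpoch (z * Q) Q n * qpoch (w * Q) Q n)^-1.
Definition kap r := (1 - z) * (1 - w) / ((1 - z * Q ^+ r) * (1 - w * Q ^+ r)).
(** When zw = 1 one has kap_(-r) = Q^(2r) kap_r, so the factor 1 + Q^r gathers the terms r and -r of
    (-1)^r Q^(r(r+1)/2) kap_r. The index 0 is counted once, with no division by (1 - z)(1 - w). *)
Definition bailey_alpha r :=
  if r == 0%N then 1 else (-1) ^+ r * Q ^+ 'C(r.+1, 2) * (1 + Q ^+ r) * kap r.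

Let unit_z (c : laurent R) r : vge 0 c -> 1 - c * Q ^+ r.+1 \is a GRing.unit.
Proof.
move=> vc; have v : vge 1 (c * Q ^+ r.+1).
  rewrite exprS; apply: vgeMl => //; exact: (vgeW (ltn0Sn _) (vge_pow vQ vQ)).
exact: (unit_1B v).1.
Qed.

Lemma bailey_beta_step n :
  bailey_beta n.+1 * ((1 - z * Q ^+ n.+1) * (1 - w * Q ^+ n.+1)) = bailey_beta n.
Proof.
have vzQ : vge 1 (z * Q) by apply: vgeMl.
have vwQ : vge 1 (w * Q) by apply: vgeMl.
have u := unit_z n vz; have u' := unit_z n vw.
have -> : bailey_beta n.+1 = bailey_beta n / ((1 - z * Q ^+ n.+1) * (1 - w * Q ^+ n.+1)).
  rewrite /bailey_beta -[in RHS]invrM ?unitrM ?qpoch_unit ?u ?u' //.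
  by congr (_^-1); rewrite !qpochS !exprS; ring.
by rewrite mulrVK // unitrM u.
Qed.

Let D n r := bailey_alpha r * ((1 - z * Q ^+ n) * (1 - w * Q ^+ n) -
    (1 - Q ^+ (n - r)) * (1 - Q ^+ (n + r))) * iq (n - r) * iq (n + r).

(** Since zw = 1, the difference inside [D n r] equals Q^(n-r) (1 - z Q^r)(1 - w Q^r). It cancels
    the denominator of [kap r], which makes the partial sums telescope. The factor 1 - Q^(n+1-m) of
    the closed form vanishes for the complete sum m = n + 1. *)
Let sumD n m : (m <= n.+1)%N -> \sum_(r < m.+1) D n.+1 r =
  (1 - z) * (1 - w) * Q ^+ n.+1 * ((-1) ^+ m * Q ^+ 'C(m.+1, 2)) *
  (1 - Q ^+ (n.+1 - m)) * iq (n.+1 - m) * iq (n.+1 + m) / (1 - Q ^+ n.+1).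
Proof.
have un : 1 - Q ^+ n.+1 \is a GRing.unit by rewrite -[Q ^+ _]mul1r unit_z //; exact: vge1.
elim: m => [|m IH] mn.
  rewrite big_ord_recr big_ord0 /= /D /bailey_alpha /= subn0 addn0 bin_small // expr0.
  rewrite [X in _ = X](_ : _ = (1 - z) * (1 - w) * Q ^+ n.+1 * iq n.+1 ^+ 2); last first.
    have e : (1 - Q ^+ n.+1)^-1 * Q ^+ n.+1 = (1 - Q ^+ n.+1)^-1 - 1.
      by rewrite -[X in _ = _ - X](mulVr un); ring.
    by ring: e.
  have -> : (1 - z) * (1 - w) = 2 - z - w by ring: zw.
  by ring: zw.
rewrite big_ord_recr IH 1?ltnW //=.
have [p np] : exists p, n = (m + p)%N by exists (n - m)%N; lia.
rewrite {1}/D /bailey_alpha /kap.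
have e1 : (n.+1 - m.+1 = p)%N by lia.
have e2 : (n.+1 - m = p.+1)%N by lia.
have e3 : (n.+1 + m.+1 = (n.+1 + m).+1)%N by lia.
have u1 : (1 - z * Q ^+ m.+1) * (1 - w * Q ^+ m.+1) \is a GRing.unit.
  by rewrite unitrM !unit_z.
rewrite e1 e2 e3 (iqS (n.+1 + m)) (iqS p).
have -> : Q ^+ 'C(m.+2, 2) = Q ^+ m.+1 * Q ^+ 'C(m.+1, 2) by rewrite binS bin1 addnC exprD.
have -> : Q ^+ (n.+1 + m).+1 = Q ^+ m.+1 * Q ^+ m.+1 * Q ^+ p by rewrite -!exprD; congr (_ ^+ _); lia.
move: un; have -> : Q ^+ n.+1 = Q ^+ m.+1 * Q ^+ p by rewrite -exprD np addSn.
move=> un.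
have i1 : (1 - Q ^+ m.+1 * Q ^+ p)^-1 * (Q ^+ m.+1 * Q ^+ p) = (1 - Q ^+ m.+1 * Q ^+ p)^-1 - 1.
  by rewrite -[X in _ = _ - X](mulVr un); ring.
move: i1 (mulVr u1); set d := (1 - _)^-1; set e := ((1 - _) * _)^-1.
move: (iq p.+1) (iq (n.+1 + m).+1) d e (Q ^+ 'C(m.+1, 2)) => I J d e c.
rewrite [Q ^+ p.+1]exprS [(-1) ^+ _.+1]exprS /=.
move: (Q ^+ m.+1) (Q ^+ p) ((-1) ^+ m) => y x s i1 i2.
have -> : (1 - z * (y * x)) * (1 - w * (y * x)) - (1 - x) * (1 - y * y * x) =
    x * ((1 - z * y) * (1 - w * y)) by ring: zw.
transitivity ((1 - z) * (1 - w) * (y * x) * (s * c) * (1 - Q * x) * I * ((1 - y * y * x) * J) * d +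
   -1 * s * (y * c) * (1 + y) * ((1 - z) * (1 - w)) *
   (e * ((1 - z * y) * (1 - w * y))) * (x * ((1 - Q * x) * I) * J)); first by ring.
rewrite i2; ring: i1.
Qed.

(* The [kap] are the partial fractions of [bailey_beta] in [z]; the recursion in [n]
   reduces to a telescoping sum. *)
Lemma bailey_pair n :
  bailey_beta n = \sum_(r < n.+1) bailey_alpha r * iq (n - r) * iq (n + r).
Proof.
elim: n => [|n IH].
  rewrite big_ord_recr big_ord0 /= /bailey_beta /bailey_alpha /iq /= !qpoch0.
  by rewrite !mulr1 invr1; ring.
have u1 : (1 - z * Q ^+ n.+1) * (1 - w * Q ^+ n.+1) \is a GRing.unit.
  by rewrite unitrM !unit_z.
apply: (mulIr u1); rewrite bailey_beta_step IH; apply/esym/eqP; rewrite -subr_eq0.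
have := sumD (leqnn n.+1); rewrite subnn expr0 subrr mulr0 !mul0r => h0.
rewrite -[X in _ == X]h0.
rewrite mulr_suml [X in _ - X](_ : _ = \sum_(r < n.+2) bailey_alpha r *
   ((1 - Q ^+ (n.+1 - r)) * (1 - Q ^+ (n.+1 + r))) * iq (n.+1 - r) * iq (n.+1 + r)).
  rewrite -sumrB; apply/eqP/eq_bigr => i _; rewrite /D; ring.
rewrite [RHS]big_ord_recr /= subnn expr0 subrr mul0r mulr0 !mul0r addr0.
apply: eq_bigr => i _; rewrite subSn -1?ltnS // iqS (iqS (n + i)) -addSn; ring.
Qed.
End Pair.

(** * The finite q-Pfaff-Saalschuetz sum *)

Section Saalschuetz.
Variables a b : laurent R.

(* [qfall c n] = c^n (1/c;Q)_n, which is also meaningful at c = 0. *)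
Definition qfall c n : laurent R := \prod_(j < n) (c - Q ^+ j).

Lemma qfallS c n : qfall c n.+1 = qfall c n * (c - Q ^+ n).
Proof. by rewrite /qfall big_ord_recr. Qed.

(** With rho_1 = 1/a and rho_2 = 1/b this is (rho_1;Q)_n (rho_2;Q)_n x^n (x;Q)_(N-n) / (Q;Q)_(N-n),
    where x = Q/(rho_1 rho_2): the weight of Bailey's lemma relative to 1. *)
Definition saal_weight N n := qfall a n * qfall b n * Q ^+ n *
  (qpoch (a * b * Q) Q (N - n) * iq (N - n)).

Let t r j := qfall a (r + j) * qfall b (r + j) * Q ^+ (r + j) * iq j * iq (2 * r + j).
Let u m := qpoch (a * b * Q) Q m * iq m.

(** Creative telescoping: the summand is the difference of the two sides of a first-order recurrence
    in M, and the right-hand side is its certificate. At J = M it cancels the extra term j = M + 1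
    of the longer sum. *)
Let sumT r M J : (J <= M)%N ->
  \sum_(j < J.+1) ((1 - Q ^+ M.+1) * (1 - Q ^+ (2 * r + M).+1) * t r j * u (M.+1 - j) -
    (1 - a * Q ^+ (r + M).+1) * (1 - b * Q ^+ (r + M).+1) * t r j * u (M - j)) =
  - (Q ^+ (r + M).+1 * qfall a (r + J).+1 * qfall b (r + J).+1 * iq J * iq (2 * r + J) * u (M - J)).
Proof.
elim: J => [|J IH] JM.
  rewrite big_ord_recr big_ord0 /= /t /u !subn0 !addn0 !qfallS qpochS (iqS M).
  have -> : Q ^+ (2 * r + M).+1 = Q * Q ^+ r * Q ^+ r * Q ^+ M by rewrite -exprS -!exprD; congr (_ ^+ _); lia.
  have -> : Q ^+ (r + M).+1 = Q * Q ^+ r * Q ^+ M by rewrite -exprS -!exprD.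
  rewrite exprS; ring.
rewrite big_ord_recr IH 1?ltnW //=.
have [p Mp] : exists p, M = (J.+1 + p)%N by exists (M - J.+1)%N; lia.
have e1 : (M.+1 - J.+1 = p.+1)%N by lia.
have e2 : (M - J.+1 = p)%N by lia.
have e3 : (M - J = p.+1)%N by lia.
rewrite e1 e2 e3 /t /u !addnS !qfallS qpochS (iqS p) (iqS J) (iqS (2 * r + J)).
have -> : Q ^+ M.+1 = Q * Q ^+ J.+1 * Q ^+ p by rewrite -exprS -!exprD; congr (_ ^+ _); lia.
have -> : Q ^+ (r + M).+1 = Q * Q ^+ r * Q ^+ J.+1 * Q ^+ p by rewrite -exprS -!exprD; congr (_ ^+ _); lia.
have -> : Q ^+ (2 * r + M).+1 = Q * Q ^+ r * Q ^+ r * Q ^+ J.+1 * Q ^+ p.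
  by rewrite -exprS -!exprD; congr (_ ^+ _); lia.
have -> : Q ^+ (2 * r + J).+1 = Q ^+ r * Q ^+ r * Q ^+ J.+1 by rewrite -!exprD; congr (_ ^+ _); lia.
have -> : Q ^+ (r + J).+1 = Q ^+ r * Q ^+ J.+1 by rewrite -!exprD; congr (_ ^+ _); lia.
have -> : Q ^+ p.+1 = Q * Q ^+ p by rewrite -exprS.
have -> : Q ^+ J.+1 = Q * Q ^+ J by rewrite -exprS.
rewrite exprD.
ring.
Qed.

(** Here n = r + j and N = r + M, so that induction on M applies; by [sumT] both sides obey the same
    first-order recurrence. *)
Lemma saalschuetz_shift r M :
  \sum_(j < M.+1) t r j * u (M - j) = qfall a r * qfall b r * Q ^+ r *
  \prod_(j < M) ((1 - a * Q ^+ (r + j).+1) * (1 - b * Q ^+ (r + j).+1)) *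
  iq M * iq (2 * r + M).
Proof.
have u1 n : 1 - Q ^+ n.+1 \is a GRing.unit.
  rewrite exprS; apply: (unit_1B _).1; exact: (vgeW (ltn0Sn _) (vge_pow vQ vQ)).
elim: M => [|M IH].
  by rewrite big_ord_recr !big_ord0 /= /t /u !addn0 qpoch0 /iq qpoch0 invr1; ring.
apply: (mulrI (u1 M)); apply: (mulrI (u1 (2 * r + M)%N)).
rewrite [in RHS]big_ord_recr /=.
transitivity ((1 - a * Q ^+ (r + M).+1) * (1 - b * Q ^+ (r + M).+1) *
    \sum_(j < M.+1) t r j * u (M - j)); last first.
  by rewrite IH (iqS M) (iqS (2 * r + M)) addnS; ring.
apply/eqP; rewrite -subr_eq0 big_ord_recr /= subnn mulrDr mulrDr.
rewrite addrAC !mulr_sumr -sumrB /=.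
rewrite (eq_bigr (fun j : 'I_M.+1 => (1 - Q ^+ M.+1) * (1 - Q ^+ (2 * r + M).+1) * t r j * u (M.+1 - j) -
    (1 - a * Q ^+ (r + M).+1) * (1 - b * Q ^+ (r + M).+1) * t r j * u (M - j))); last by move=> i _; ring.
rewrite sumT // subnn /t /u !addnS (iqS M) (iqS (2 * r + M)) /iq qpoch0.
by apply/eqP; ring.
Qed.
End Saalschuetz.

(* The finite (q-Pfaff-Saalschuetz) form of Bailey's lemma, with [a], [b] in place of
   1/rho_1, 1/rho_2 so that the limits rho -> infinity are the values 0. *)
Lemma saalschuetz a b r N : (r <= N)%N ->
  \sum_(r <= n < N.+1) saal_weight a b N n * iq (n - r) * iq (n + r) =
  qfall a r * qfall b r * Q ^+ r *
  \prod_(r <= j < N) ((1 - a * Q ^+ j.+1) * (1 - b * Q ^+ j.+1)) * iq (N - r) * iq (N + r).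
Proof.
move=> rN; have := saalschuetz_shift a b r (N - r).
have e : (2 * r + (N - r) = N + r)%N by lia.
rewrite e => h; rewrite -{1}[r]add0n big_addn subSn // big_mkord.
have -> : \prod_(r <= j < N) ((1 - a * Q ^+ j.+1) * (1 - b * Q ^+ j.+1)) =
    \prod_(j < N - r) ((1 - a * Q ^+ (r + j).+1) * (1 - b * Q ^+ (r + j).+1)).
  rewrite -{1}[r]add0n big_addn big_mkord; apply: eq_bigr => j _; by rewrite addnC.
rewrite -h; apply: eq_bigr => i _.
have e1 : (i + r - r = i)%N by lia.
have e2 : (i + r + r = 2 * r + i)%N by lia.
have e3 : (N - (i + r) = N - r - i)%N by lia.
by rewrite /saal_weight e1 e2 e3 [(i + r)%N]addnC; ring.
Qed.

End BaileyPair.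

(** * Symmetrized binomial weights and coefficient functionals *)

Section Binz.
Definition ffz (x : int) (k : nat) : int := \prod_(j < k) (x - j%:Z).

Lemma ffzS x k : ffz x k.+1 = ffz x k * (x - k%:Z).
Proof. by rewrite /ffz big_ord_recr. Qed.

Lemma ffzSl x k : ffz x k.+1 = x * ffz (x - 1) k.
Proof.
rewrite /ffz big_ord_recl subr0; congr (_ * _); apply: eq_bigr => i _.
by rewrite /= /bump /=; lia.
Qed.

Lemma ffz_pascal x k : ffz (x + 1) k.+1 = ffz x k.+1 + k.+1%:Z * ffz x k.
Proof. by rewrite ffzSl ffzS addrK intS; ring. Qed.

(** By Pascal's rule and the case k, divisibility in the case k + 1 is invariant under x |-> x + 1.
    Induction over the integers then runs in both directions from x = 0, where the product
    vanishes. *)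
Lemma dvdz_ffz x k : (k`!%:Z %| ffz x k)%Z.
Proof.
elim: k x => [|k IH] x; first by rewrite /ffz big_ord0.
have st y : (k.+1`!%:Z %| ffz (y + 1) k.+1)%Z = (k.+1`!%:Z %| ffz y k.+1)%Z.
  rewrite ffz_pascal rpredDr // factS PoszM.
  by apply: dvdz_mul.
elim: x => [|n IHn|n IHn]; first by rewrite ffzSl mul0r dvdz0.
  by rewrite -addn1 PoszD st.
by rewrite -st; have -> : - n.+1%:Z + 1 = - n%:Z by lia.
Qed.

Lemma binzE x k : binz x k * k`!%:Z = ffz x k.
Proof. by rewrite /binz divzK // dvdz_ffz. Qed.

Lemma binz_pascal x k : binz (x + 1) k.+1 = binz x k.+1 + binz x k.
Proof.
have f0 : k.+1`!%:Z != 0 by rewrite -lt0n fact_gt0.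
by apply: (mulIf f0); rewrite mulrDl !binzE ffz_pascal factS PoszM mulrCA binzE; ring.
Qed.

Definition symw (k : nat) (m : int) : int := binz (m + k%:Z - 1) (2 * k).

Lemma symw_diff k m : symw k.+1 (m + 1) - 2 * symw k.+1 m + symw k.+1 (m - 1) = symw k m.
Proof.
rewrite /symw mulnS.
have -> : m + 1 + k.+1%:Z - 1 = (m + k%:Z - 1) + 1 + 1 by lia.
have -> : m + k.+1%:Z - 1 = (m + k%:Z - 1) + 1 by lia.
have -> : m - 1 + k.+1%:Z - 1 = (m + k%:Z - 1) by lia.
by rewrite !binz_pascal; ring.
Qed.

Lemma symw0 m : symw 0 m = 1.
Proof. by rewrite /symw /binz big_ord0. Qed.

(** The falling factorial of k of length 2k + 2 contains the factor k - k. With [lwt1] this makes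
    the functional vanish on the term r = 0. *)
Lemma symwS0 k : symw k.+1 0 = 0.
Proof.
have f0 : (2 * k.+1)`!%:Z != 0 by rewrite -lt0n fact_gt0.
apply: (mulIf f0); rewrite binzE mul0r /ffz.
have kk : (k < 2 * k.+1)%N by lia.
by rewrite (bigD1 (Ordinal kk)) //= (_ : _ - k%:Z = 0) ?mul0r //; lia.
Qed.
End Binz.

(** * Series in q alone inside R((z))((q)) *)

Section Lconst.
Variable R : comNzRingType.

Lemma lmonoMl (x : R) e (F : laurent R) d : (lmono x e * F) d = x * F (d - e).
Proof.
rewrite [LHS]/= /lmul_fun.
transitivity (\sum_(i \in [set e]) mono_fun x e i * F (d - i)).
  symmetry; apply: fsbig_widen => // i [_ /= /eqP ie].
  by rewrite /mono_fun (negPf ie) mul0r.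
by rewrite fsbig_set1 /mono_fun eqxx.
Qed.

Lemma lconstMl (x : R) (F : laurent R) d : (lconst x * F) d = x * F d.
Proof. by rewrite lmonoMl subr0. Qed.

Fact lconst_zmod : zmod_morphism (@lconst R).
Proof. by move=> x y; apply: laurentP => i /=; rewrite /mono_fun; case: eqP; rewrite ?subr0. Qed.
Fact lconst_monoid : monoid_morphism (@lconst R).
Proof. by split=> // x y; apply: laurentP => i; rewrite lconstMl /= /mono_fun; case: eqP; rewrite ?mulr0. Qed.
HB.instance Definition _ := GRing.isZmodMorphism.Build _ _ _ lconst_zmod.
HB.instance Definition _ := GRing.isMonoidMorphism.Build _ _ _ lconst_monoid.

Fact emb_bounded (b : laurent R) : lower_bounded (fun d => lconst (b d)).
Proof.
apply/asboolP; have [N bN] := laurent_bound b.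
by exists N => i /bN ->; rewrite rmorph0.
Qed.
(* Series in q that do not involve z. *)
Definition emb (b : laurent R) : laurent (laurent R) := Laurent (emb_bounded b).

Fact emb_zmod : zmod_morphism emb.
Proof. by move=> x y; apply: laurentP => i /=; rewrite -rmorphB. Qed.
Fact emb_monoid : monoid_morphism emb.
Proof.
split=> [|x y].
  by apply: laurentP => i; rewrite /= /mono_fun; case: eqP; rewrite ?rmorph1 ?rmorph0.
apply: laurentP => d.
have [N xN] := laurent_bound x; have [M yM] := laurent_bound y.
have exN i : i < N -> emb x i = 0 by move=> /xN /= ->; rewrite rmorph0.
have eyM i : i < M -> emb y i = 0 by move=> /yM /= ->; rewrite rmorph0.
rewrite [RHS]/=; have [dNM | /int_above[n ->]] := ltP d (N + M).
  by rewrite (lmul_fun_low exN eyM) //= (lmul_fun_low xN yM) // rmorph0.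
rewrite (lmul_funE _ exN eyM) /= (lmul_funE _ xN yM) rmorph_sum /=.
by apply: eq_bigr => i _; rewrite rmorphM.
Qed.
HB.instance Definition _ := GRing.isZmodMorphism.Build _ _ _ emb_zmod.
HB.instance Definition _ := GRing.isMonoidMorphism.Build _ _ _ emb_monoid.

Lemma emb_lvar : emb lvar = lvar.
Proof.
by apply: laurentP => i; rewrite /= /mono_fun; case: eqP => _; rewrite ?rmorph1 ?rmorph0.
Qed.

Lemma vge_emb N b : vge N b -> vge N (emb b).
Proof. by move=> vb i /vb /= ->; rewrite rmorph0. Qed.

Lemma lcvg_emb f F : lcvg f F -> lcvg (emb \o f) (emb F).
Proof.
by move=> cF N; have [n0 h] := cF N; exists n0 => n /h v /=; rewrite -rmorphB; apply: vge_emb.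
Qed.

Lemma emb_qpoch a q n : emb (qpoch a q n) = qpoch (emb a) (emb q) n.
Proof.
rewrite rmorph_prod; apply: eq_bigr => i _.
by rewrite rmorphB rmorph1 rmorphM rmorphXn.
Qed.

Lemma emb_qpoch_inf a q : vge 1 a -> vge 1 q ->
  emb (qpoch_inf a q) = qpoch_inf (emb a) (emb q).
Proof.
move=> va vq; apply: (@lcvg_unique _ (emb \o qpoch a q)); first exact/lcvg_emb/qpoch_lcvg.
by apply: eq_lcvg (qpoch_lcvg (vge_emb va) (vge_emb vq)) => n; rewrite /= emb_qpoch.
Qed.
End Lconst.

(** * Linear functionals on the coefficients in z *)

Section Functional.
Local Notation ser := (laurent int).
Local Notation ser2 := (laurent ser).
Implicit Types (G H : ser) (F : ser2) (w : int -> int).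

(** A sum [\sum_(m \in ...)] takes the default value 0 on an infinite support, so additivity of
    [ell] rests on finiteness in both directions, which membership in Z((z)) does not give. *)
Definition lfin G := exists N : nat, forall m : int, (N <= absz m)%N -> G m = 0.

Lemma lfinD G H : lfin G -> lfin H -> lfin (G + H).
Proof.
move=> [N GN] [M HM]; exists (maxn N M) => m; rewrite geq_max => /andP[/GN g /HM h].
by rewrite /= g h.
Qed.
Lemma lfin_mono x e G : lfin G -> lfin (lmono x e * G).
Proof. by move=> [N GN]; exists (N + absz e)%N => m Nm; rewrite lmonoMl GN ?mulr0 //; lia. Qed.
Lemma lfin0 : lfin 0. Proof. by exists 0%N. Qed.
Lemma lfin1 : lfin 1.
Proof. by exists 1%N => m; rewrite /= /mono_fun; case: eqP => // ->. Qed.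
Lemma lfin_sum (I : Type) (r : seq I) (P : pred I) (t : I -> ser) :
  (forall i, P i -> lfin (t i)) -> lfin (\sum_(i <- r | P i) t i).
Proof.
by move=> vt; apply: big_ind => [|F G|]; [exact: lfin0 | exact: lfinD | exact: vt].
Qed.

Definition ell w G : int := \sum_(m \in [set: int]) w m * G m.

Lemma ellE w G (N : nat) : (forall m : int, (N <= absz m)%N -> G m = 0) ->
  ell w G = \sum_(i < 2 * N) w (i%:Z - N%:Z) * G (i%:Z - N%:Z).
Proof.
move=> GN; pose s := [seq i%:Z - N%:Z | i <- index_iota 0 (2 * N)].
have us : uniq s by rewrite map_inj_uniq ?iota_uniq // => i j /addIr [].
transitivity (\sum_(i <- s) w i * G i); last by rewrite big_map big_mkord.
rewrite (fsbig_seq _ _ us) /=; symmetry; apply: fsbig_widen => // m [_ /= ms].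
rewrite GN ?mulr0 // leqNgt; apply/negP => mN; apply: ms; apply/mapP.
by exists (absz (m + N%:Z)); rewrite ?mem_index_iota; lia.
Qed.

Lemma ell0 w : ell w 0 = 0.
Proof. by rewrite (@ellE _ _ 0) // big_ord0. Qed.
Lemma ell1 w : ell w 1 = w 0.
Proof.
rewrite (@ellE _ _ 1); last by move=> m; rewrite /= /mono_fun; case: eqP => // ->.
by rewrite !big_ord_recr big_ord0 /= /mono_fun /= mulr0 !add0r mulr1.
Qed.
Lemma ellD w G H : lfin G -> lfin H -> ell w (G + H) = ell w G + ell w H.
Proof.
move=> [N GN] [M HM]; pose K := maxn N M.
have GK m : (K <= absz m)%N -> G m = 0 by rewrite geq_max => /andP[/GN].
have HK m : (K <= absz m)%N -> H m = 0 by rewrite geq_max => /andP[_ /HM].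
rewrite (ellE _ GK) (ellE _ HK) (@ellE _ (G + H) K); last by move=> m Km; rewrite /= GK ?HK.
by rewrite -big_split; apply: eq_bigr => i _ /=; rewrite mulrDr.
Qed.
Lemma ell_sum w (I : Type) (r : seq I) (t : I -> ser) : (forall i, lfin (t i)) ->
  ell w (\sum_(i <- r) t i) = \sum_(i <- r) ell w (t i).
Proof.
move=> ft; elim: r => [|i r IH]; first by rewrite !big_nil ell0.
by rewrite !big_cons ellD ?IH //; apply: lfin_sum.
Qed.
Lemma ell_mono w x e G : ell w (lmono x e * G) = x * ell (fun m => w (m + e)) G.
Proof.
rewrite /ell mulr_fsumr (reindex_fsbigT (fun m : int => m + e)); last first.
  by exists (fun m => m - e) => m; rewrite ?addrK ?subrK.
by apply: eq_fsbigr => m _; rewrite lmonoMl addrK mulrCA.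
Qed.

Lemma ell_const w x G : ell w (lconst x * G) = x * ell w G.
Proof.
rewrite /ell mulr_fsumr; apply: eq_fsbigr => m _.
by rewrite (lconstMl x G m) mulrCA.
Qed.

Definition zfin F := forall d, lfin (F d).

Fact lwt_bounded w F : lower_bounded (fun d => ell w (F d)).
Proof. by apply/asboolP; have [N FN] := laurent_bound F; exists N => i /FN ->; exact: ell0. Qed.
Definition lwt w F : ser := Laurent (lwt_bounded w F).

Lemma zfinD F F' : zfin F -> zfin F' -> zfin (F + F').
Proof. by move=> f f' d; apply: lfinD. Qed.
Lemma lwtD w F F' : zfin F -> zfin F' -> lwt w (F + F') = lwt w F + lwt w F'.
Proof. by move=> f f'; apply: laurentP => d; apply: ellD. Qed.
Lemma zfin1 : zfin 1.
Proof.
by move=> d; rewrite /= /mono_fun; case: eqP => _; [exact: lfin1 | exact: lfin0].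
Qed.
Lemma lwt1 w : lwt w 1 = lconst (w 0).
Proof.
by apply: laurentP => d; rewrite /= /mono_fun; case: eqP => _; rewrite ?ell1 ?ell0.
Qed.
Lemma zfin0 : zfin 0. Proof. by move=> d; exact: lfin0. Qed.
Lemma lwt0 w : lwt w 0 = 0.
Proof. by apply: laurentP => d; apply: ell0. Qed.
Lemma zfin_sum (I : Type) (r : seq I) (t : I -> ser2) :
  (forall i, zfin (t i)) -> zfin (\sum_(i <- r) t i).
Proof. by move=> vt; apply: big_ind => [|F G|]; [exact: zfin0 | exact: zfinD | ]. Qed.
Lemma lwt_sum w (I : Type) (r : seq I) (t : I -> ser2) : (forall i, zfin (t i)) ->
  lwt w (\sum_(i <- r) t i) = \sum_(i <- r) lwt w (t i).
Proof.
move=> ft; elim: r => [|i r IH]; first by rewrite !big_nil lwt0.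
by rewrite !big_cons lwtD ?IH //; apply: zfin_sum.
Qed.

(** Both products are finite convolutions with the same bounds N and M, so that [ell w] can be
    applied term by term; this yields linearity of [lwt w] over series in q. *)
Lemma emb_mulE b F : exists N M : int, [/\ forall d, d < N + M -> (emb b * F) d = 0,
  forall d, d < N + M -> forall w, (b * lwt w F) d = 0 &
  forall n : nat, (emb b * F) (N + M + n%:Z) =
     \sum_(i < n.+1) lconst (b (N + i%:Z)) * F (M + (n - i)%N%:Z) /\
  forall w, (b * lwt w F) (N + M + n%:Z) =
     \sum_(i < n.+1) b (N + i%:Z) * ell w (F (M + (n - i)%N%:Z))].
Proof.
have [N bN] := laurent_bound b; have [M FM] := laurent_bound F.
have ebN i : i < N -> emb b i = 0 by move=> /bN /= ->; rewrite rmorph0.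
have lFM w i : i < M -> lwt w F i = 0 by move=> /FM /= ->; exact: ell0.
exists N, M; split=> [d dl|d dl w|n]; first exact: lmul_fun_low dl.
  exact: lmul_fun_low bN (lFM w) dl.
by split=> [|w]; [exact: lmul_funE | exact: (lmul_funE _ bN (lFM w))].
Qed.

Lemma zfin_emb b F : zfin F -> zfin (emb b * F).
Proof.
move=> zF d; have [N [M [low _ hi]]] := emb_mulE b F.
have [/low -> | /int_above[n ->]] := ltP d (N + M); first exact: lfin0.
by rewrite (hi n).1; apply: lfin_sum => i _; apply: lfin_mono.
Qed.

Lemma lwt_emb w b F : zfin F -> lwt w (emb b * F) = b * lwt w F.
Proof.
move=> zF; apply: laurentP => d; change (ell w ((emb b * F) d) = (b * lwt w F) d).
have [N [M [low low' hi]]] := emb_mulE b F.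
have [dl | /int_above[n ->]] := ltP d (N + M); first by rewrite low' // low // ell0.
rewrite (hi n).2 (hi n).1 ell_sum => [|i]; last exact: lfin_mono.
apply: eq_bigr => i _; exact: ell_const.
Qed.

Lemma zfin_zmono x e F : zfin F -> zfin (lconst (lmono x e) * F).
Proof. by move=> zF d; rewrite (lconstMl (lmono x e) F d); apply: lfin_mono. Qed.

Lemma lwt_zmono w x e F :
  lwt w (lconst (lmono x e) * F) = lconst x * lwt (fun m => w (m + e)) F.
Proof. apply: laurentP => d; rewrite [RHS]lconstMl.
change (ell w ((lconst (lmono x e) * F) d) = x * ell (fun m => w (m + e)) (F d)).
by rewrite (lconstMl (lmono x e) F d) ell_mono.
Qed.

(** F' = F + x z^e y F' with y = O(q): each coefficient of F' in q comes from F and from finitely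
    many lower coefficients of F', so finiteness follows by strong induction. *)
Lemma zfin_geom x e (y : ser) F F' : vge 1 y -> zfin F ->
  (1 - lconst (lmono x e) * emb y) * F' = F -> zfin F'.
Proof.
move=> vy zF eF.
have e1 : F' = F + lconst (lmono x e) * (emb y * F') by rewrite -eF; ring.
have [M FM] := laurent_bound F'.
have evy i : i < 1 -> emb y i = 0 by move=> /vy /= ->; rewrite rmorph0.
move=> d; have [/FM -> | /int_above[n ->{d}]] := ltP d M; first exact: lfin0.
elim/ltn_ind: n => n IH; rewrite e1; apply: lfinD; first exact: zF.
rewrite (lconstMl (lmono x e) (emb y * F')); apply: lfin_mono.
case: n IH => [|n] IH.
  by rewrite [X in lfin X]/= (lmul_fun_low evy FM) ?addr0 //; [exact: lfin0 | lia].
have -> : M + n.+1%:Z = 1 + M + n%:Z by lia.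
rewrite [X in lfin X]/= (lmul_funE _ evy FM); apply: lfin_sum => i _.
by apply: lfin_mono; apply: IH; rewrite ltnS leq_subr.
Qed.

(** Each coefficient of F in q coincides with that of [f n] for large n, so the functional passes to
    the limit coefficient by coefficient. *)
Lemma lwt_lcvg w (f : nat -> ser2) F : lcvg f F -> lcvg (fun n => lwt w (f n)) (lwt w F).
Proof.
move=> cf N; have [n0 h] := cf N; exists n0 => n /h v i iN /=.
have -> : f n i = F i by apply/eqP; rewrite -subr_eq0; apply/eqP/v.
by rewrite subrr.
Qed.
End Functional.

(** * Moments of Bailey sums *)

Section Moments.
Local Notation ser := (laurent int).
Local Notation ser2 := (laurent ser).

Lemma z2V : z2^-1 = lconst (lmono 1 (- 1)).
Proof.
have e : lconst (lmono 1 (- 1)) * z2 = 1 :> ser2.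
  by rewrite -rmorphM /= lmonoM mulr1 addNr.
have u : z2 \is a GRing.unit by apply/unitrPr; exists (lconst (lmono 1 (- 1))); rewrite mulrC.
exact: (mulIr u (etrans (mulVr u) (esym e))).
Qed.

Lemma z2_mulV : z2 * z2^-1 = 1.
Proof. by rewrite z2V -rmorphM /= lmonoM mulr1 subrr. Qed.

Lemma vge_z2 : vge 0 z2. Proof. exact: vge_lconst. Qed.
Lemma vge_z2V : vge 0 z2^-1. Proof. by rewrite z2V; exact: vge_lconst. Qed.

Lemma ell_second_diff (w w' : int -> int) (G : ser) :
  (forall m, w (m + 1) - 2 * w m + w (m - 1) = w' m) -> lfin G ->
  2 * ell w G + (-1 * ell (fun m => w (m + 1)) G + -1 * ell (fun m => w (m - 1)) G) =
  - ell w' G.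
Proof.
move=> ww [N GN]; have eE v := ellE v GN.
rewrite !eE !mulr_sumr -sumrN -!big_split /=.
by apply: eq_bigr => i _; rewrite -ww; ring.
Qed.

(** Multiplication by z or 1/z shifts the weight by 1 or -1, and (1 - z)(1 - 1/z) = 2 - z - 1/z is
    minus the second difference. *)
Lemma lwt_second_diff (w w' : int -> int) (F : ser2) :
  (forall m, w (m + 1) - 2 * w m + w (m - 1) = w' m) -> zfin F ->
  lwt w ((1 - z2) * (1 - z2^-1) * F) = - lwt w' F.
Proof.
move=> ww zF; have -> : (1 - z2) * (1 - z2^-1) * F = emb 2 * F +
   (lconst (lmono (-1) 1) * F + lconst (lmono (-1) (-1)) * F).
  have -> : (1 - z2) * (1 - z2^-1) * F = (2 - z2 - z2^-1) * F by ring: z2_mulV.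
  have lmonoN x : lconst (lmono (-1) x) = - lconst (lmono 1 x) :> ser2.
    rewrite -rmorphN /=; congr lconst; apply: laurentP => i; rewrite /= /mono_fun.
    by case: eqP; rewrite ?oppr0.
  by rewrite !lmonoN -z2V rmorph_nat -[lconst (lmono 1 1)]/z2; ring.
have z1 := zfin_zmono (-1) 1 zF; have z3 := zfin_zmono (-1) (-1) zF.
rewrite lwtD; [|exact: zfin_emb|exact: zfinD].
rewrite (lwtD _ z1 z3) (lwt_emb _ _ zF) !lwt_zmono.
have -> : 2 = lconst 2 :> ser by rewrite rmorph_nat.
apply: laurentP => d; rewrite [RHS](_ : _ = - ell w' (F d)) // -(ell_second_diff ww (zF d)).
by congr (_ + (_ + _)); apply: lconstMl.
Qed.

(** * Values on the reciprocal of (1 - zy)(1 - y/z) *)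

Section Geometric.
Variable y : ser.
Hypothesis vy : vge 1 y.

Let u : (1 - z2 * emb y) * (1 - z2^-1 * emb y) \is a GRing.unit.
Proof.
have v1 : vge 1 (z2 * emb y) by apply: vgeMl; [exact: vge_z2 | exact: vge_emb].
have v2 : vge 1 (z2^-1 * emb y) by apply: vgeMl; [exact: vge_z2V | exact: vge_emb].
by rewrite unitrM (unit_1B v1).1 (unit_1B v2).1.
Qed.

Let g := ((1 - z2 * emb y) * (1 - z2^-1 * emb y))^-1.

Lemma zfin_recip : zfin g.
Proof.
have h1 : zfin ((1 - z2^-1 * emb y) * g).
  by apply: (zfin_geom (x := 1) (e := 1) vy zfin1); rewrite mulrA mulrV.
by apply: (zfin_geom (x := 1) (e := -1) vy h1); rewrite -z2V.
Qed.

Lemma zfin_kappa : zfin ((1 - z2) * (1 - z2^-1) * g).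
Proof.
have zg := zfin_recip.
have -> : (1 - z2) * (1 - z2^-1) * g = emb 2 * g +
   (emb (-1) * (lconst (lmono 1 1) * g) + emb (-1) * (lconst (lmono 1 (-1)) * g)).
  rewrite -z2V rmorph_nat rmorphN1 -[lconst (lmono 1 1)]/z2.
  by ring: z2_mulV.
by apply: zfinD; [|apply: zfinD]; apply: zfin_emb => //; apply: zfin_zmono.
Qed.
Lemma unit_1By : 1 - y \is a GRing.unit.
Proof. exact: (unit_1B vy).1. Qed.

(* The recursion in [k] comes from
   (1 - z y) (1 - y / z) = (1 - y)^2 + y (1 - z) (1 - 1 / z). *)
Lemma lwt_recip k : lwt (symw k) g = y ^+ k / (1 - y) ^+ (2 * k.+1).
Proof.
have zg := zfin_recip.
have e : 1 = emb ((1 - y) ^+ 2) * g + emb y * ((1 - z2) * (1 - z2^-1) * g) :> ser2.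
  rewrite -[LHS](mulrV u) -/g rmorphXn rmorphB rmorph1; ring: z2_mulV.
have zd := zfin_kappa.
have uk j : (1 - y) ^+ j \is a GRing.unit by rewrite unitrX // unit_1By.
have e' j : lconst (symw j 0) = (1 - y) ^+ 2 * lwt (symw j) g +
    y * lwt (symw j) ((1 - z2) * (1 - z2^-1) * g).
  rewrite -lwt1 -(lwt_emb _ _ zg) -(lwt_emb _ _ zd).
  by rewrite -(lwtD _ (zfin_emb _ zg) (zfin_emb _ zd)) -e.
have diff0 m : symw 0 (m + 1) - 2 * symw 0 m + symw 0 (m - 1) = (fun=> 0) m.
  by rewrite !symw0.
elim: k => [|k IH].
  (* The constant weight w_0 = 1 amounts to setting z = 1, which annihilates the term with (1 - z)(1
     - 1/z). *)
  have := e' 0%N; rewrite (lwt_second_diff diff0 zg) symw0 rmorph1.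
  have -> : lwt (fun=> 0) g = 0.
    by apply: laurentP => d; apply: fsbig1 => m _; rewrite mul0r.
  rewrite oppr0 mulr0 addr0 expr0 => e0.
  by apply: (mulrI (uk 2%N)); apply: (etrans (esym e0)); rewrite muln1 mul1r mulrV.
have := e' k.+1; rewrite (lwt_second_diff (symw_diff k) zg) symwS0 rmorph0 IH mulrN.
move/esym/eqP; rewrite subr_eq0 => /eqP e1.
apply: (mulrI (uk 2%N)); have -> : (2 * k.+2 = 2 + 2 * k.+1)%N by lia.
rewrite e1 (exprS y k) exprD invrM //.
rewrite -[LHS]mulr1 -[X in _ * X = _](mulrV (uk 2%N)).
set U := (1 - y) ^+ 2; move: (U^-1) ((1 - y) ^- (2 * k.+1)) => U' V'; ring.
Qed.

Lemma lwt_kappa k :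
  lwt (symw k.+1) ((1 - z2) * (1 - z2^-1) * g) = - (y ^+ k / (1 - y) ^+ (2 * k.+1)).
Proof. by rewrite (lwt_second_diff (symw_diff k) zfin_recip) lwt_recip. Qed.

End Geometric.

Lemma lvarX (R : comNzRingType) n : lvar ^+ n = lmono 1 n%:Z :> laurent R.
Proof. by elim: n => [|n IH] //; rewrite exprS IH lmonoM mulr1 -intS. Qed.

Lemma gf_posE (f : nat -> int) (G : ser) :
  vge 1 G -> (forall n : nat, (0 < n)%N -> G n%:Z = f n) -> gf_pos f = G.
Proof.
move=> vG Gf.
have te n d : ((f n)%:~R * q1 ^+ n) d = if d == n%:Z then f n else 0.
  have -> : (f n)%:~R = lconst (f n) :> ser by rewrite -{2}[f n]intz rmorph_int.
  by rewrite lvarX lconstMl /= /mono_fun; case: eqP; rewrite ?mulr1 ?mulr0.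
apply: lsumE => d; split.
  apply: (@sub_finite_set _ _ `I_(absz d).+1); last exact: finite_II.
  by move=> n [_]; rewrite te; case: (d =P n%:Z) => [-> _|_]; rewrite ?eqxx // /mkset; lia.
have [d1|d1] := ltP d 1.
  rewrite vG // fsbig1 // => n n1; rewrite te; case: (d =P n%:Z) => // dn.
  by move: n1; rewrite /mkset => n1; lia.
have [m md] : exists m : nat, d = m%:Z by exists (absz d); lia.
rewrite -(fsbig_widen [set m]).
- by rewrite fsbig_set1 te md eqxx Gf; lia.
- by move=> i /= ->; lia.
- by move=> i [_ im]; rewrite /preimage /mkset te; case: (d =P i%:Z) => // di; case: im => /=; lia.
Qed.

Lemma triangle_sum (V : zmodType) (h : nat -> nat -> V) N :
  \sum_(n < N) \sum_(r < n.+1) h n r = \sum_(r < N) \sum_(r <= n < N) h n r.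
Proof.
transitivity (\sum_(n < N) \sum_(r < N | (r <= n)%N) h n r).
  by apply: eq_bigr => n _; rewrite (big_ord_widen N (h n)).
rewrite (exchange_big_dep xpredT) //=.
by apply: eq_bigr => r _; rewrite big_geq_mkord.
Qed.

Lemma emb_iq (Q : ser) n : vge 1 Q -> emb (iq Q n) = iq (emb Q) n.
Proof. by move=> vQ; rewrite /iq rmorphV ?qpoch_unit //= emb_qpoch. Qed.

Lemma bin2_ge r : (r <= 'C(r.+1, 2))%N.
Proof. by case: r => // r; rewrite binS bin1 leq_addl. Qed.

(** The value of the functional with weight [symw k.+1], that is of the moment of order 2(k + 1), on
    alpha_r for r >= 1; the exponent r + 1 of -1 absorbs the minus sign of [lwt_kappa]. *)
Definition crank_term (Q : ser) k r : ser :=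
  (-1) ^+ (r + 1) * Q ^+ ('C(r.+1, 2) + r * k) * (1 + Q ^+ r) / (1 - Q ^+ r) ^+ (2 * k.+1).

(** * Bailey's transform of truncated weights and its limit *)

Section Limit.
Variables (Q : ser) (A B : nat -> nat -> ser) (gam : nat -> ser) (F : ser2).
Hypotheses (vQ : vge 1 Q)
  (limF : lcvg (fun N => \sum_(n < N.+1) emb (A N n) * bailey_beta (emb Q) z2 z2^-1 n) F)
  (AB : forall N r, (r <= N)%N ->
    \sum_(r <= n < N.+1) A N n * iq Q (n - r) * iq Q (n + r) = B N r)
  (vB : forall N r, (r <= N)%N -> vge 0 (B N r))
  (limB : forall r, lcvg (fun N => B N r) (gam r)).

Let alpha := bailey_alpha (emb Q) z2 z2^-1.
Let vQX r : vge r (Q ^+ r).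
Proof. by rewrite -[r in vge r]mul1n; apply: vgeX. Qed.

Lemma vge_crank_term k r : vge r.+1 (crank_term Q k r.+1).
Proof.
have v1 : vge 1 (Q ^+ r.+1) := vgeW (ltn0Sn _) (@vQX r.+1).
have v0 : vge 0 (Q ^+ r.+1) := vgeW (leq0n _) (@vQX r.+1).
apply: vgeMr; last by rewrite -exprVn; apply/vge0X/(unit_1B v1).2.
apply: vgeMr; last by apply: vgeD => //; exact: vge1.
apply: vgeMl; first by apply/vge0X/vgeN/vge1.
by apply: vgeW (@vQX _); apply: leq_trans (bin2_ge _) (leq_addr _ _).
Qed.

Let alphaE r : alpha r.+1 = emb ((-1) ^+ r.+1 * Q ^+ 'C(r.+2, 2) * (1 + Q ^+ r.+1)) *
  ((1 - z2) * (1 - z2^-1) / ((1 - z2 * emb (Q ^+ r.+1)) * (1 - z2^-1 * emb (Q ^+ r.+1)))).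
Proof.
by rewrite /alpha /bailey_alpha /kap /= !rmorphM rmorphD rmorph1 !rmorphXn rmorphN1.
Qed.

Let zalpha r : zfin (alpha r).
Proof.
case: r => [|r]; first exact: zfin1.
rewrite alphaE; apply/zfin_emb/zfin_kappa; exact: (vgeW (ltn0Sn _) (@vQX r.+1)).
Qed.

Let lalpha k r : lwt (symw k.+1) (alpha r) = if r == 0%N then 0 else crank_term Q k r.
Proof.
case: r => [|r]; first by rewrite /alpha /bailey_alpha /= lwt1 symwS0 rmorph0.
have v1 : vge 1 (Q ^+ r.+1) := vgeW (ltn0Sn _) (@vQX r.+1).
rewrite alphaE lwt_emb ?lwt_kappa //; last exact: zfin_kappa.
rewrite /crank_term addn1 -exprM (exprD Q) [(-1) ^+ r.+2]exprS /=.
set V := ((1 - _) ^- _); ring.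
Qed.

(** Bailey's transform: insert [bailey_pair], exchange the two finite sums, and recognize [B N r] in
    the inner one. *)
Let FE N : \sum_(n < N.+1) emb (A N n) * bailey_beta (emb Q) z2 z2^-1 n =
  \sum_(r < N.+1) emb (B N r) * alpha r.
Proof.
have vQ' := vge_emb vQ.
under eq_bigr => n _.
  rewrite (bailey_pair vQ' z2_mulV vge_z2 vge_z2V) mulr_sumr.
  over.
rewrite (triangle_sum (fun n r => emb (A N n) * (alpha r * iq (emb Q) (n - r) * iq (emb Q) (n + r)))).
apply: eq_bigr => r _; rewrite -AB ?rmorph_sum -1?ltnS // mulr_suml.
by apply: eq_bigr => n _; rewrite !rmorphM /= !emb_iq //; ring.
Qed.

(** For each N, [A N] and [B N] form a conjugate Bailey pair relative to 1. The functional is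
    evaluated on the finite sums of [B N r] times alpha_r, and [tannery] then gives the limit, with
    [lwt (symw k.+1) F] as the other limit of the same sequence. *)
Lemma moment_limit k : gf_pos (sym_moment (coef_zq F) (2 * k.+1)) =
  sum_pos (fun r => gam r * crank_term Q k r).
Proof.
pose t r := if r == 0%N then 0 else gam r * crank_term Q k r.
have vgam r : vge 0 (gam r).
  move=> i i0; have [n0 h] := limB r 0; have := h (maxn n0 r) (leq_maxl _ _) i i0.
  by move=> /= /eqP; rewrite subr_eq0 => /eqP <-; rewrite vB // leq_maxr.
have vt r : vge r (t r).
  by rewrite /t; case: r => [|r]; [exact: vge0 | apply: vgeMl => //; exact: vge_crank_term].
have tz r : ~ (1 <= r)%N -> t r = 0 by case: r.
have limt := lsum_lcvg vt tz.
have <- : lsum [set n | (1 <= n)%N] t = sum_pos (fun r => gam r * crank_term Q k r).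
  by apply: eq_lsum => -[|r].
set S := lsum _ t.
have limS : lcvg (fun N => lwt (symw k.+1) (\sum_(r < N.+1) emb (B N r) * alpha r)) S.
  apply: (@eq_lcvg _ (fun N => \sum_(r < N.+1) B N r * lwt (symw k.+1) (alpha r))).
    by move=> N; rewrite lwt_sum => [|r]; [apply: eq_bigr => r _; rewrite lwt_emb | apply: zfin_emb].
  apply: (@tannery _ (fun N r => B N r * lwt (symw k.+1) (alpha r)) t) limt => [N r rN|r].
    rewrite lalpha; case: r rN => [|r] rN /=; first by rewrite mulr0; exact: vge0.
    by apply: vgeMl; [exact: vB | exact: vge_crank_term].
  rewrite lalpha /t; case: r => [|r] /=.
    by apply: eq_lcvg (lcvg_cst 0) => N; rewrite mulr0.
  move=> N; have [n1 h] := limB r.+1 N; exists n1 => n /h vv; rewrite -mulrBl.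
  by apply: vgeMr => //; apply: vgeW (@vge_crank_term k r).
have limL : lcvg (fun N => lwt (symw k.+1) (\sum_(r < N.+1) emb (B N r) * alpha r)) (lwt (symw k.+1) F).
  by apply: eq_lcvg (lwt_lcvg _ limF) => N; rewrite FE.
rewrite (lcvg_unique limS limL); apply: gf_posE.
  (* That no power of q below q^1 occurs is read off the partial fraction series, whose terms start
     at r = 1. *)
  rewrite -(lcvg_unique limS limL); apply: lcvg_vge limt => n.
  by apply: vge_sum => -[[|r] rn] _; [exact: vge0 | apply: (@vgeW _ r.+1)].
move=> n n0; apply: eq_fsbigr => m _; congr (binz _ _ * _).
(* The floor of (2(k + 1) - 1)/2 is k, the shift built into [symw k.+1]. *)
have -> : ((2 * k.+1)%:Z - 1 = k%:Z * 2 + 1)%R by lia.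
by rewrite divzMDl // addr0; lia.
Qed.
End Limit.
End Moments.

(** * Crank and rank type series *)

Section Applications.
Local Notation ser := (laurent int).
Local Notation ser2 := (laurent ser).
Implicit Types (Q C a b : ser) (k n r : nat).

Lemma lcvg_iq Q (h : nat -> nat) : vge 1 Q ->
  (forall n, exists m0, forall m, (m0 <= m)%N -> (n <= h m)%N) ->
  lcvg (fun N => iq Q (h N)) (qpoch_inf Q Q)^-1.
Proof. by move=> vQ hh; apply: (lcvg_comp hh (qpochV_lcvg vQ vQ).2). Qed.

Lemma sub_tends r n : exists m0, forall m, (m0 <= m)%N -> (n <= m - r)%N.
Proof. by exists (n + r)%N; lia. Qed.
Lemma add_tends r n : exists m0, forall m, (m0 <= m)%N -> (n <= m + r)%N.
Proof. by exists n; lia. Qed.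

(** The weight sits at n = N alone, so the truncations are C times beta_N, which converge to the
    infinite product, and C / ((Q;Q)_(N-r) (Q;Q)_(N+r)) tends to C / (Q;Q)_inf^2. *)
Lemma crank_moment Q C k : vge 1 Q -> vge 0 C ->
  gf_pos (sym_moment (coef_zq (emb C / (qpoch_inf (z2 * emb Q) (emb Q) *
     qpoch_inf (z2^-1 * emb Q) (emb Q)))) (2 * k.+1)) =
  sum_pos (fun r => C / qpoch_inf Q Q ^+ 2 * crank_term Q k r).
Proof.
move=> vQ vC; have vQ' := vge_emb vQ.
have vz : vge 1 (z2 * emb Q) by apply: vgeMl => //; exact: vge_z2.
have vw : vge 1 (z2^-1 * emb Q) by apply: vgeMl => //; exact: vge_z2V.
have [uz cz] := qpochV_lcvg vz vQ'; have [uw cw] := qpochV_lcvg vw vQ'.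
have viq n : vge 0 (iq Q n) := vge_qpochV n vQ vQ.
apply: (@moment_limit Q (fun N n => if n == N then C else 0)
   (fun N r => C * iq Q (N - r) * iq Q (N + r))) => //.
- rewrite invrM //; apply: (@eq_lcvg _ (fun N => emb C *
    ((qpoch (z2^-1 * emb Q) (emb Q) N)^-1 * (qpoch (z2 * emb Q) (emb Q) N)^-1))).
    move=> N; rewrite big_ord_recr /= eqxx big1 ?add0r => [|i _].
      by rewrite /bailey_beta invrM ?qpoch_unit.
    by rewrite ltn_eqF // rmorph0 mul0r.
  apply: lcvgMl; first exact: vge_emb.
    by move=> n; apply: vgeMl; apply: vge_qpochV.
  by apply: lcvgM => // n; apply: vge_qpochV.
- move=> N r rN; rewrite big_nat_recr //= eqxx big_nat big1 ?add0r // => i /andP[_ iN].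
  by rewrite ltn_eqF // !mul0r.
- by move=> N r _; apply: vgeMl => //; apply: vgeMl.
- move=> r; rewrite expr2 invrM ?(qpochV_lcvg vQ vQ).1 //.
  apply: (@eq_lcvg _ (fun N => C * (iq Q (N - r) * iq Q (N + r)))).
    by move=> N; rewrite mulrA.
  apply: lcvgMl => //; first by move=> n; apply: vgeMl.
  by apply: lcvgM => //; apply: lcvg_iq => //; [exact: sub_tends | exact: add_tends].
Qed.

Lemma prod_qpoch a Q r N : vge 1 (a * Q) -> vge 1 Q -> (r <= N)%N ->
  \prod_(r <= j < N) (1 - a * Q ^+ j.+1) = qpoch (a * Q) Q N / qpoch (a * Q) Q r.
Proof.
move=> vaQ vQ; elim: N => [|N IH].
  by rewrite leqn0 => /eqP ->; rewrite big_geq // !qpoch0 divr1.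
rewrite leq_eqVlt => /orP[/eqP ->|rN].
  by rewrite big_geq // mulrV // qpoch_unit.
by rewrite big_nat_recr //= IH // qpochS exprS; ring.
Qed.

(** * Ranks: the two-parameter weights of Bailey's lemma *)

Section Rank.
Variables Q a b : ser.
Hypotheses (vQ : vge 1 Q) (va : vge 1 (a * Q)) (vb : vge 1 (b * Q)) (vab : vge 1 (a * b * Q)).

Definition rank_weight n := qfall Q a n * qfall Q b n * Q ^+ n.
Hypothesis vw : forall n, vge n (rank_weight n).

(** The valuation hypotheses bear on aQ, bQ, abQ and the weights, since the parameters used later
    include -1 and -1/q, which are not O(q). *)
Lemma rank_moment k :
  gf_pos (sym_moment (coef_zq (lsum setT (fun n => emb (rank_weight n) *
    bailey_beta (emb Q) z2 z2^-1 n))) (2 * k.+1)) =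
  sum_pos (fun r => (qpoch_inf (a * Q) Q * qpoch_inf (b * Q) Q /
      (qpoch_inf Q Q * qpoch_inf (a * b * Q) Q) *
    (rank_weight r / (qpoch (a * Q) Q r * qpoch (b * Q) Q r))) * crank_term Q k r).
Proof.
have v0Q := vgeW (leqnSn 0) vQ; have v0a := vgeW (leqnSn 0) va.
have v0b := vgeW (leqnSn 0) vb; have v0ab := vgeW (leqnSn 0) vab.
have vQ' := vge_emb vQ.
have [uQ cQ] := qpochV_lcvg vQ vQ; have [uab _] := qpochV_lcvg vab vQ.
have viq n : vge 0 (iq Q n) := vge_qpochV n vQ vQ.
have vw0 n : vge 0 (rank_weight n) by apply: vgeW (@vw n).
have vbeta n : vge 0 (bailey_beta (emb Q) z2 z2^-1 n).
  have vz : vge 1 (z2 * emb Q) by apply: vgeMl => //; exact: vge_z2.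
  have vzV : vge 1 (z2^-1 * emb Q) by apply: vgeMl => //; exact: vge_z2V.
  by rewrite /bailey_beta invrM ?qpoch_unit //; apply: vgeMl; apply: vge_qpochV.
(* (abQ;Q)_(N-n) / (Q;Q)_(N-n) tends to the inverse of C, so that C times [saal_weight] tends to
   [rank_weight]. *)
pose C := qpoch_inf Q Q / qpoch_inf (a * b * Q) Q.
have vC : vge 0 C by apply: vgeMl; [exact: vge_qpoch_inf | exact: vge_qpoch_infV].
pose D r := rank_weight r / (qpoch (a * Q) Q r * qpoch (b * Q) Q r).
have vD r : vge 0 (D r).
  by apply: vgeMl => //; rewrite invrM ?qpoch_unit //; apply: vgeMl; apply: vge_qpochV.
have vs N n : vge 0 (qpoch (a * b * Q) Q N * iq Q n) by apply: vgeMl => //; apply: vge_qpoch.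
have vAB N : vge 0 (qpoch (a * Q) Q N * qpoch (b * Q) Q N) by apply: vgeMl; apply: vge_qpoch.
apply: (@moment_limit Q (fun N n => C * saal_weight Q a b N n)
   (fun N r => C * D r * ((qpoch (a * Q) Q N * qpoch (b * Q) Q N) * (iq Q (N - r) * iq Q (N + r))))) => //.
- apply: (@tannery _ (fun N n => emb (C * saal_weight Q a b N n) * bailey_beta (emb Q) z2 z2^-1 n)
     (fun n => emb (rank_weight n) * bailey_beta (emb Q) z2 z2^-1 n)).
  + move=> N n nN; apply: vgeMr => //; apply: vge_emb; apply: vgeMl => //.
    by apply: vgeMr => //; exact: vw.
  + move=> n; apply: lcvgM => [N|N||]; last exact: lcvg_cst.
    * apply/vge_emb/vgeMl => //; apply: vgeMl; [exact: vw0 | exact: vs].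
    * exact: vbeta.
    have e : rank_weight n = C * rank_weight n * (qpoch_inf (a * b * Q) Q * (qpoch_inf Q Q)^-1).
      transitivity (rank_weight n * (qpoch_inf Q Q / qpoch_inf Q Q) *
          (qpoch_inf (a * b * Q) Q / qpoch_inf (a * b * Q) Q)).
        by rewrite !mulrV // !mulr1.
      by rewrite /C; ring.
    apply: lcvg_emb; rewrite [X in lcvg _ X]e.
    apply: (@eq_lcvg _ (fun N => C * rank_weight n * (qpoch (a * b * Q) Q (N - n) * iq Q (N - n)))).
      by move=> N; rewrite /saal_weight -/(rank_weight n); ring.
    apply: lcvgMl => //; first exact: vgeMl.
    apply: lcvgM => // [m||]; first exact: vge_qpoch.
      apply: (lcvg_comp (h := fun N => (N - n)%N) _ (qpoch_lcvg vab vQ)); exact: sub_tends.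
    apply: lcvg_iq => //; exact: sub_tends.
  + by apply: lsum_lcvg => [n|n [] //]; apply: vgeMr => //; apply: vge_emb; exact: vw.
- move=> N r rN; transitivity (C * \sum_(r <= n < N.+1) saal_weight Q a b N n * iq Q (n - r) * iq Q (n + r)).
    by rewrite mulr_sumr; apply: eq_bigr => n _; rewrite !mulrA.
  rewrite (saalschuetz vQ a b rN) big_split /= (prod_qpoch va vQ rN) (prod_qpoch vb vQ rN).
  rewrite -/(rank_weight r) /D invrM ?qpoch_unit //.
  set X := (qpoch _ _ r)^-1; set Y := (qpoch _ _ r)^-1.
  by ring.
- move=> N r _; apply: vgeMl; first exact: vgeMl.
  by apply: vgeMl => //; apply: vgeMl.
- move=> r; rewrite [X in lcvg _ X](_ : _ = C * D r * ((qpoch_inf (a * Q) Q * qpoch_inf (b * Q) Q) *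
     ((qpoch_inf Q Q)^-1 * (qpoch_inf Q Q)^-1))).
    apply: lcvgMl; first exact: vgeMl.
      by move=> n; apply: vgeMl => //; apply: vgeMl.
    apply: lcvgM => // [n||].
    + exact: vgeMl.
    + by apply: lcvgM => [n|n||]; [exact: vge_qpoch | exact: vge_qpoch | exact: qpoch_lcvg | exact: qpoch_lcvg].
    + by apply: lcvgM => //; apply: lcvg_iq => //; [exact: sub_tends | exact: add_tends].
  rewrite /C -/(D r) [(qpoch_inf Q Q * _)^-1]invrM //.
  set X := (qpoch_inf Q Q)^-1; rewrite -[LHS]mulr1 -[Y in _ * Y](mulrV uQ) -/X.
  by move: (qpoch_inf (a * b * Q) Q)^-1 => Y; ring.
Qed.
End Rank.

End Applications.

(** * Folding sums over nonzero integers *)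

Section NonzeroSums.
Local Notation ser := (laurent int).

(** Only indices of absolute value at most that of d reach the coefficient of q^d, so both sides
    reduce there to finite sums over the same n. *)
Lemma sum_nonzeroE (t : int -> ser) :
  (forall n : nat, (0 < n)%N -> vge n (t n%:Z) /\ vge n (t (- n%:Z))) ->
  sum_nonzero t = sum_pos (fun n => t n%:Z + t (- n%:Z)).
Proof.
move=> vt; apply: lsumE => d.
have vtt n : (1 <= n)%N -> vge n (t n%:Z + t (- n%:Z)).
  by move=> /vt [v v']; apply: vgeD.
have [_ ->] := lsumP vtt d.
pose r := index_iota 1 (absz d).+1.
pose s := [seq n%:Z | n <- r] ++ [seq - n%:Z | n <- r].
have us : uniq s.
  rewrite cat_uniq !map_inj_uniq ?iota_uniq //=; first last.
  - by move=> i j; lia.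
  - by move=> i j; lia.
  rewrite andbT; apply/hasPn => _ /mapP[i ir ->]; apply/negP => /mapP[j jr].
  by move: ir jr; rewrite !mem_index_iota; lia.
have sP i : i != 0 -> i \notin s -> t i d = 0.
  move=> i0 si; have [ds|ds] := leqP (absz d).+1 (absz i).
    have [v v'] : vge (absz i) (t (absz i)%:Z) /\ vge (absz i) (t (- (absz i)%:Z)) by apply: vt; lia.
    have [ip|ip] : i = (absz i)%:Z \/ i = - (absz i)%:Z by lia.
      by rewrite ip; apply: v; lia.
    by rewrite ip; apply: v'; lia.
  exfalso; move/negP: si; apply; rewrite mem_cat; apply/orP.
  have [ip|ip] : i = (absz i)%:Z \/ i = - (absz i)%:Z by lia.
    by left; apply/mapP; exists (absz i) => //; rewrite mem_index_iota; lia.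
  by right; apply/mapP; exists (absz i) => //; rewrite mem_index_iota; lia.
split.
  apply: (sub_finite_set _ (finite_seq s)) => i [/= i0 td].
  by apply/negPn/negP => /(sP _ i0) /eqP; apply/negP.
have s0 i : i \in s -> i != 0.
  by rewrite mem_cat => /orP[] /mapP[j]; rewrite mem_index_iota; lia.
rewrite -(fsbig_widen [set` s]); first last.
- by move=> i [/= i0 /negP si]; apply: sP.
- by move=> i /= /s0.
rewrite -(fsbig_widen [set` r]); first last.
- move=> i [/= i1]; rewrite mem_index_iota => /negP ir.
  by apply: (vtt _ i1); lia.
- by move=> i /=; rewrite mem_index_iota; lia.
rewrite -(fsbig_seq _ _ us) -fsbig_seq ?iota_uniq //.
by rewrite big_cat !big_map /= -big_split.
Qed.

Lemma divr_mul2r (R : comUnitRingType) (x w y : R) : w \is a GRing.unit ->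
  y \is a GRing.unit -> x * w / (w * y) = x / y.
Proof. by move=> uw uy; rewrite invrM // [y^-1 * _]mulrC mulrA mulrK. Qed.

Lemma q1_unit : q1 \is a GRing.unit. Proof. exact: lvar_unit. Qed.

Lemma q1z_unit (m : int) : q1 ^ m \is a GRing.unit.
Proof.
by apply/unitrPr; exists (q1 ^ (- m)); rewrite -exprzDr ?q1_unit // subrr.
Qed.

Lemma vge_q1X n : vge n (q1 ^+ n).
Proof. by rewrite -[n in vge n]mul1n; apply/vgeX/vge_lvar. Qed.

Lemma unit_q1B m : (0 < m)%N -> 1 - q1 ^+ m \is a GRing.unit /\ vge 0 (1 - q1 ^+ m)^-1.
Proof. by move=> m0; apply/unit_1B/(vgeW m0)/vge_q1X. Qed.

Lemma unit_q1D m : (0 < m)%N -> 1 + q1 ^+ m \is a GRing.unit /\ vge 0 (1 + q1 ^+ m)^-1.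
Proof. by move=> m0; rewrite -[q1 ^+ m]opprK; apply/unit_1B/vgeN/(vgeW m0)/vge_q1X. Qed.

Lemma signzN (n : nat) : (-1 : ser) ^ (- n%:Z + 1) = (-1) ^+ (n + 1).
Proof.
have u : (-1 : ser) \is a GRing.unit by rewrite unitrN1.
by rewrite exprzDr // -exprz_inv invrN1 -exprnP exprD.
Qed.

(** The exponent 2k is even, hence (1 - q^(-m))^(2k) = q^(-2km) (1 - q^m)^(2k), and -km turns into
    +km. *)
Lemma reflect_minus (c : int) (k m : nat) : (0 < m)%N ->
  q1 ^ (c - k%:Z * m%:Z) / (1 - q1 ^ (- m%:Z)) ^+ (2 * k) =
  q1 ^ (c + k%:Z * m%:Z) / (1 - q1 ^+ m) ^+ (2 * k).
Proof.
move=> m0; have uX : (1 - q1 ^+ m) ^+ (2 * k) \is a GRing.unit by rewrite unitrX // (unit_q1B m0).1.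
have uw : q1 ^ (- m%:Z) \is a GRing.unit by rewrite q1z_unit.
have e : q1 ^ (- m%:Z) * q1 ^+ m = 1 by rewrite exprnP -exprzDr ?q1_unit // addNr.
have -> : (1 - q1 ^ (- m%:Z)) ^+ (2 * k) = (q1 ^ (- m%:Z)) ^+ (2 * k) * (1 - q1 ^+ m) ^+ (2 * k).
  by rewrite -exprMn mulrBr mulr1 e !exprM; congr (_ ^+ _); ring.
have -> : q1 ^ (c - k%:Z * m%:Z) = q1 ^ (c + k%:Z * m%:Z) * (q1 ^ (- m%:Z)) ^+ (2 * k).
  rewrite exprnP exprz_exp -exprzDr ?q1_unit //; congr (_ ^ _); lia.
exact: (divr_mul2r _ (unitrX _ uw) uX).
Qed.

Lemma reflect_plus (m : nat) : (0 < m)%N ->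
  (1 + q1 ^ (- m%:Z))^-1 = q1 ^+ m / (1 + q1 ^+ m).
Proof.
move=> m0; have [u _] := unit_q1D m0.
have e : q1 ^ (- m%:Z) * q1 ^+ m = 1 by rewrite exprnP -exprzDr ?q1_unit // addNr.
have uw : q1 ^ (- m%:Z) \is a GRing.unit by rewrite q1z_unit.
have -> : 1 + q1 ^ (- m%:Z) = q1 ^ (- m%:Z) * (1 + q1 ^+ m) by rewrite mulrDr e mulr1 addrC.
by rewrite -(divr_mul2r _ uw u) [q1 ^+ m * _]mulrC e div1r.
Qed.

(** * Pairing the summands of index n and -n *)

Section Fold.
Variables (k s : nat) (E : int -> int) (e : nat -> nat).
Hypotheses (s0 : (0 < s)%N) (le_e : forall n, (n <= e n)%N).

(** After reflection the terms n and -n carry q^(e(n) + sn) and q^(e(n)) over the same denominator,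
    whence the factor 1 + q^(sn). *)
Lemma fold_minus :
  (forall n : nat, (0 < n)%N -> E n%:Z + k%:Z * (s * n)%:Z = (e n + s * n)%N%:Z) ->
  (forall n : nat, (0 < n)%N -> E (- n%:Z) + k%:Z * (s * n)%:Z = (e n)%:Z) ->
  sum_nonzero (fun n => (-1) ^ (n + 1) * q1 ^ (E n + k%:Z * (s%:Z * n)) /
     (1 - q1 ^ (s%:Z * n)) ^+ (2 * k)) =
  sum_pos (fun n => (-1) ^+ (n + 1) * q1 ^+ e n * (1 + q1 ^+ (s * n)) /
     (1 - q1 ^+ (s * n)) ^+ (2 * k)).
Proof.
move=> Ep En.
have sn0 n : (0 < n)%N -> (0 < s * n)%N by move=> n0; rewrite muln_gt0 s0.
pose t (j : int) : ser := (-1) ^ (j + 1) * q1 ^ (E j + k%:Z * (s%:Z * j)) / (1 - q1 ^ (s%:Z * j)) ^+ (2 * k).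
have tp (n : nat) : (0 < n)%N ->
    t n%:Z = (-1) ^+ (n + 1) * q1 ^+ (e n + s * n) / (1 - q1 ^+ (s * n)) ^+ (2 * k).
  by move=> n0; rewrite /t -PoszM Ep // -PoszD -!exprnP.
have tn (n : nat) : (0 < n)%N ->
    t (- n%:Z) = (-1) ^+ (n + 1) * q1 ^+ (e n) / (1 - q1 ^+ (s * n)) ^+ (2 * k).
  move=> n0; rewrite /t signzN mulrN -PoszM mulrN -!mulrA reflect_minus ?sn0 //.
  by rewrite En.
have vV n : (0 < n)%N -> vge 0 ((1 - q1 ^+ (s * n)) ^- (2 * k)).
  by move=> n0; rewrite -exprVn; apply/vge0X/(unit_q1B (sn0 _ n0)).2.
have vS n : vge 0 ((-1) ^+ (n + 1) : ser) by apply/vge0X/vgeN/vge1.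
rewrite (@sum_nonzeroE t) => [|n n0]; last first.
  rewrite tp // tn //; split; (apply: vgeMr; last exact: vV); apply: (vgeMl (vS n)).
    by apply: vgeW (@vge_q1X _); apply: leq_trans (le_e n) (leq_addr _ _).
  by apply: vgeW (@vge_q1X _).
by apply: eq_lsum => n n0; rewrite tp // tn // (exprD q1); ring.
Qed.

(** Reflecting 1/(1 + q^(sn)) contributes an extra q^(sn), which explains the second hypothesis; the
    terms n and -n then add up to a factor 1 + q^(sn) that cancels this denominator. *)
Lemma fold_plus :
  (forall n : nat, (0 < n)%N -> E n%:Z + k%:Z * (s * n)%:Z = (e n + s * n)%N%:Z) ->
  (forall n : nat, (0 < n)%N -> E (- n%:Z) + k%:Z * (s * n)%:Z + (s * n)%:Z = (e n)%:Z) ->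
  sum_nonzero (fun n => (-1) ^ (n + 1) * q1 ^ (E n + k%:Z * (s%:Z * n)) /
     ((1 + q1 ^ (s%:Z * n)) * (1 - q1 ^ (s%:Z * n)) ^+ (2 * k))) =
  sum_pos (fun n => (-1) ^+ (n + 1) * q1 ^+ e n / (1 - q1 ^+ (s * n)) ^+ (2 * k)).
Proof.
move=> Ep En.
have sn0 n : (0 < n)%N -> (0 < s * n)%N by move=> n0; rewrite muln_gt0 s0.
pose t (j : int) : ser := (-1) ^ (j + 1) * q1 ^ (E j + k%:Z * (s%:Z * j)) /
  ((1 + q1 ^ (s%:Z * j)) * (1 - q1 ^ (s%:Z * j)) ^+ (2 * k)).
pose g n : ser := (1 + q1 ^+ (s * n))^-1 / (1 - q1 ^+ (s * n)) ^+ (2 * k).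
have uX n : (0 < n)%N -> (1 - q1 ^+ (s * n)) ^+ (2 * k) \is a GRing.unit.
  by move=> n0; rewrite unitrX // (unit_q1B (sn0 _ n0)).1.
have uD n : (0 < n)%N -> 1 + q1 ^+ (s * n) \is a GRing.unit.
  by move=> n0; rewrite (unit_q1D (sn0 _ n0)).1.
have tp (n : nat) : (0 < n)%N ->
    t n%:Z = (-1) ^+ (n + 1) * q1 ^+ (e n + s * n) * g n.
  move=> n0; rewrite /t -PoszM Ep // -PoszD -!exprnP invrM ?uX ?uD //.
  by rewrite /g [X in _ = _ * X]mulrC.
have tn (n : nat) : (0 < n)%N -> t (- n%:Z) = (-1) ^+ (n + 1) * q1 ^+ (e n) * g n.
  move=> n0; rewrite /t signzN mulrN -PoszM mulrN.
  have um := q1z_unit (- (s * n)%:Z).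
  have ew : q1 ^ (- (s * n)%:Z) * q1 ^+ (s * n) = 1.
    by rewrite exprnP -exprzDr ?q1_unit // addNr.
  have u1 : 1 + q1 ^ (- (s * n)%:Z) \is a GRing.unit.
    have -> : 1 + q1 ^ (- (s * n)%:Z) = q1 ^ (- (s * n)%:Z) * (1 + q1 ^+ (s * n)).
      by rewrite mulrDr ew mulr1 addrC.
    by rewrite unitrM um uD.
  have u2 : 1 - q1 ^ (- (s * n)%:Z) \is a GRing.unit.
    have -> : 1 - q1 ^ (- (s * n)%:Z) = - (q1 ^ (- (s * n)%:Z) * (1 - q1 ^+ (s * n))).
      by rewrite mulrBr ew mulr1 opprB.
    by rewrite unitrN unitrM um (unit_q1B (sn0 _ n0)).1.
  rewrite (invrM u1 (unitrX _ u2)).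
  transitivity ((-1) ^+ (n + 1) * (q1 ^ (E (- n%:Z) - k%:Z * (s * n)%:Z) /
      (1 - q1 ^ (- (s * n)%:Z)) ^+ (2 * k)) * (1 + q1 ^ (- (s * n)%:Z))^-1).
    by rewrite !mulrA.
  rewrite reflect_minus ?sn0 // reflect_plus ?sn0 // /g (exprnP q1 (e n)) -(En _ n0).
  rewrite (exprzDr q1_unit (_ + _) (s * n)%N%:Z) -(exprnP q1 (s * n)%N).
  by set x := (1 + _)^-1; set y := (1 - _) ^- _; ring.
have vg n : (0 < n)%N -> vge 0 (g n).
  move=> n0; apply: vgeMl; first exact: (unit_q1D (sn0 _ n0)).2.
  by rewrite -exprVn; apply/vge0X/(unit_q1B (sn0 _ n0)).2.
have vS n : vge 0 ((-1) ^+ (n + 1) : ser) by apply/vge0X/vgeN/vge1.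
rewrite (@sum_nonzeroE t) => [|n n0]; last first.
  rewrite tp // tn //; split; (apply: vgeMr; last exact: vg); apply: (vgeMl (vS n)).
    by apply: vgeW (@vge_q1X _); apply: leq_trans (le_e n) (leq_addr _ _).
  by apply: vgeW (@vge_q1X _).
apply: eq_lsum => n n0; rewrite tp // tn // (exprD q1) /g.
rewrite -[X in _ = X / _]mulr1 -[X in _ = _ * X / _](mulrV (uD n n0)).
set a := (1 + _)^-1; set b := (1 - _) ^- _; ring.
Qed.
End Fold.
End NonzeroSums.

(** * The six families *)

#[local] Opaque vge.

Section Cases.
Local Notation ser := (laurent int).
Local Notation ser2 := (laurent ser).
Local Notation q := q1.
Implicit Types (k n r : nat).

Local Notation P1 := (qpoch_inf (- q) (q ^+ 2) / qpoch_inf (q ^+ 2) (q ^+ 2)).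
Local Notation P2 := (qpoch_inf (- q) q / qpoch_inf q q).

Lemma vq : vge 1 q. Proof. exact: vge_lvar. Qed.
Lemma vNq : vge 1 (- q). Proof. exact/vgeN/vq. Qed.
Lemma vq2 : vge 1 (q ^+ 2). Proof. by apply: vgeW (vge_q1X (n := 2)). Qed.
Hint Resolve vq vNq vq2 : core.

Lemma qpoch_inf_unit (a Q : ser) : vge 1 a -> vge 1 Q -> qpoch_inf a Q \is a GRing.unit.
Proof. by move=> va vQ; case: (qpochV_lcvg va vQ). Qed.

Lemma emb_q1 : emb q = q2. Proof. exact: emb_lvar. Qed.

Lemma vP1 : vge 0 P1.
Proof. by apply: vgeMl; [exact: vge_qpoch_inf | exact: vge_qpoch_infV]. Qed.
Lemma vP2 : vge 0 P2.
Proof. by apply: vgeMl; [exact: vge_qpoch_inf | exact: vge_qpoch_infV]. Qed.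
Hint Resolve vP1 vP2 : core.

Lemma divr_mul3 (R : comUnitRingType) (a d x y : R) : d \is a GRing.unit ->
  x \is a GRing.unit -> y \is a GRing.unit -> a / (d * x * y) = a / d / (x * y).
Proof.
move=> ud ux uy; have uxy : x * y \is a GRing.unit by rewrite unitrM ux.
by rewrite -[d * x * y]mulrA (invrM ud uxy) [(x * y)^-1 * _]mulrC mulrA.
Qed.

Lemma divr_mulrr (R : comUnitRingType) (a d b : R) : d \is a GRing.unit ->
  b \is a GRing.unit -> a * b / d / (b * b) = a / (d * b).
Proof.
move=> ud ub; rewrite (invrM ub ub) (invrM ud ub) -[RHS]mulr1 -[X in _ = _ * X](mulrV ub).
by move: (d^-1) (b^-1) => x y; ring.
Qed.

Lemma two_bin2 n : (2 * 'C(n.+1, 2) = n * n.+1)%N.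
Proof. by rewrite -[n in RHS]bin1 -mul_bin_diag bin1 mulnC. Qed.

Lemma vge_summand k m (e : nat) r (c : ser) : (0 < m)%N -> (r <= e)%N -> vge 0 c ->
  vge r ((-1) ^+ (r + 1) * q ^+ e * c / (1 - q ^+ m) ^+ (2 * k)).
Proof.
move=> m0 re vc; apply: vgeMr; last first.
  by rewrite -exprVn; apply/vge0X/(unit_q1B m0).2.
apply: vgeMr => //; apply: vgeMl; first by apply/vge0X/vgeN/vge1.
by apply: vgeW (@vge_q1X e).
Qed.

Lemma vge0_q1D m : vge 0 (1 + q ^+ m).
Proof. by apply: vgeD; [exact: vge1 | apply: vgeW (@vge_q1X m)]. Qed.

Lemma sum_posMl (c : ser) (t : nat -> ser) : vge 0 c ->
  (forall n, (0 < n)%N -> vge n (t n)) -> c * sum_pos t = sum_pos (fun n => c * t n).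
Proof. exact: lsumMl. Qed.

(** * The three crank families *)

Lemma M2_moment k : gf_pos (mu2 (2 * k.+1)) =
  P1 * sum_pos (fun n => (-1) ^+ (n + 1) * q ^+ (n * (n - 1) + 2 * k.+1 * n) *
    (1 + q ^+ (2 * n)) / (1 - q ^+ (2 * n)) ^+ (2 * k.+1)).
Proof.
have C0 : vge 0 (qpoch_inf (- q) (q ^+ 2) * qpoch_inf (q ^+ 2) (q ^+ 2)).
  by apply: vgeMl; apply: vge_qpoch_inf.
have := crank_moment k vq2 C0.
rewrite rmorphM /= !emb_qpoch_inf // rmorphN rmorphXn /= emb_q1 => ->.
rewrite (sum_posMl vP1) => [|n n1]; last by apply: vge_summand; [lia | nia | exact: vge0_q1D].
apply: eq_lsum => r r1; rewrite /crank_term -!exprM.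
(* Twice the exponent is r(r + 1) + 2kr, which is r(r - 1) + 2(k + 1)r in terms of the moment order
   2(k + 1). *)
have -> : (2 * ('C(r.+1, 2) + r * k) = r * (r - 1) + 2 * k.+1 * r)%N.
  by rewrite mulnDr two_bin2; nia.
have -> : qpoch_inf (- q) (q ^+ 2) * qpoch_inf (q ^+ 2) (q ^+ 2) / qpoch_inf (q ^+ 2) (q ^+ 2) ^+ 2 = P1.
  by rewrite expr2 divr_mul2r // qpoch_inf_unit.
by rewrite !mulrA.
Qed.

Lemma Mbar_moment k : gf_pos (mu_bar (2 * k.+1)) =
  P2 * sum_pos (fun n => (-1) ^+ (n + 1) * q ^+ ((n * (n - 1)) %/ 2 + k.+1 * n) *
    (1 + q ^+ n) / (1 - q ^+ n) ^+ (2 * k.+1)).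
Proof.
have C0 : vge 0 (qpoch_inf (- q) q * qpoch_inf q q).
  by apply: vgeMl; apply: vge_qpoch_inf.
have := crank_moment k vq C0.
rewrite rmorphM /= !emb_qpoch_inf // rmorphN /= emb_q1 => ->.
rewrite (sum_posMl vP2) => [|n n1]; last first.
  by apply: vge_summand; [lia | nia | exact: vge0_q1D].
apply: eq_lsum => r r1; rewrite /crank_term.
have -> : ('C(r.+1, 2) + r * k = (r * (r - 1)) %/ 2 + k.+1 * r)%N.
  by rewrite binS bin1 bin2 subn1 divn2; nia.
have -> : qpoch_inf (- q) q * qpoch_inf q q / qpoch_inf q q ^+ 2 = P2.
  by rewrite expr2 divr_mul2r // qpoch_inf_unit.
by rewrite !mulrA.
Qed.

Lemma M2bar_moment k : gf_pos (mu2_bar (2 * k.+1)) =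
  P2 * sum_pos (fun n => (-1) ^+ (n + 1) * q ^+ (n * (n - 1) + 2 * k.+1 * n) *
    (1 + q ^+ (2 * n)) / (1 - q ^+ (2 * n)) ^+ (2 * k.+1)).
Proof.
have [C CE] : exists C, C = qpoch_inf (- q) q * qpoch_inf (q ^+ 2) (q ^+ 2) / qpoch_inf q (q ^+ 2).
  by eexists.
have C0 : vge 0 C.
  rewrite CE; by apply: vgeMl; [apply: vgeMl; apply: vge_qpoch_inf | apply: vge_qpoch_infV].
have e : M2bar_gf = emb C / (qpoch_inf (z2 * emb (q ^+ 2)) (emb (q ^+ 2)) *
    qpoch_inf (z2^-1 * emb (q ^+ 2)) (emb (q ^+ 2))).
  have eC : emb C = qpoch_inf (- q2) q2 * qpoch_inf (q2 ^+ 2) (q2 ^+ 2) / qpoch_inf q2 (q2 ^+ 2).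
    rewrite CE rmorphM rmorphM (rmorphV _ (qpoch_inf_unit vq vq2)) /=.
    rewrite (emb_qpoch_inf vNq vq) (emb_qpoch_inf vq2 vq2) (emb_qpoch_inf vq vq2).
    rewrite rmorphN rmorphXn /= emb_q1; exact: erefl.
  have vQ2 := vge_emb vq; have vQ22 := vge_emb vq2.
  rewrite emb_q1 in vQ2; rewrite rmorphXn /= emb_q1 in vQ22.
  have vz : vge 1 (z2 * q2 ^+ 2) by apply: vgeMl => //; exact: vge_z2.
  have vzV : vge 1 (z2^-1 * q2 ^+ 2) by apply: vgeMl => //; exact: vge_z2V.
  rewrite eC rmorphXn /= emb_q1; apply: divr_mul3.
  - exact: (qpochV_lcvg vQ2 vQ22).1.
  - exact: (qpochV_lcvg vz vQ22).1.
  - exact: (qpochV_lcvg vzV vQ22).1.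
have := crank_moment k vq2 C0; rewrite -e => ->.
rewrite (sum_posMl vP2) => [|n n1]; last by apply: vge_summand; [lia | nia | exact: vge0_q1D].
apply: eq_lsum => r r1; rewrite /crank_term -!exprM.
have -> : (2 * ('C(r.+1, 2) + r * k) = r * (r - 1) + 2 * k.+1 * r)%N.
  by rewrite mulnDr two_bin2; nia.
(* One factor (q^2;q^2)_inf cancels and the other joins (q;q^2)_inf to form (q;q)_inf. *)
have -> : C / qpoch_inf (q ^+ 2) (q ^+ 2) ^+ 2 = P2.
  rewrite CE (qpoch_inf_split vq vq) -expr2 expr2.
  exact: (divr_mulrr _ (qpoch_inf_unit vq vq2) (qpoch_inf_unit vq2 vq2)).
by rewrite !mulrA.
Qed.

(** * The three rank families *)

Lemma qpoch_0l (Q : ser) n : qpoch 0 Q n = 1.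
Proof. by rewrite /qpoch big1 // => i _; rewrite mul0r subr0. Qed.

Lemma qpoch_inf_0l (Q : ser) : qpoch_inf 0 Q = 1.
Proof. by apply: lprodE => d; exists 0%N => n _; rewrite -[LHS]/(qpoch 0 Q n d) qpoch_0l. Qed.

Lemma q1V_mul : - q^-1 * q ^+ 2 = - q.
Proof. by rewrite expr2 mulNr mulrA mulVr ?q1_unit // mul1r. Qed.

(** Here a = 0 stands for rho_1 = infinity and b = -1/q for rho_2 = -q; the inverse of q enters only
    through bQ = -q. *)
Lemma N2_weight n : rank_weight (q ^+ 2) 0 (- q^-1) n = q ^+ (n ^ 2) * qpoch (- q) (q ^+ 2) n.
Proof.
rewrite /rank_weight; elim: n => [|n IH].
  by rewrite /qfall !big_ord0 qpoch0 !mulr1.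
rewrite !qfallS qpochS; set w := (q ^+ 2) ^+ n.
transitivity ((qfall (q ^+ 2) 0 n * qfall (q ^+ 2) (- q^-1) n * w) *
    (w * (- (- q^-1 * q ^+ 2) + w * q ^+ 2))).
  by rewrite (exprS (q ^+ 2) n) -/w; ring.
rewrite IH q1V_mul; have -> : q ^+ (n.+1 ^ 2) = q ^+ (n ^ 2) * (w * q).
  by rewrite /w -exprM -exprSr -exprD; congr (_ ^+ _); lia.
ring.
Qed.

(** The parameters are rho_1 = infinity and rho_2 = -1. *)
Lemma Nbar_weight n : rank_weight q 0 (-1) n = qpoch (-1) q n * q ^+ 'C(n.+1, 2).
Proof.
rewrite /rank_weight; elim: n => [|n IH].
  by rewrite /qfall !big_ord0 qpoch0 !mulr1.
rewrite !qfallS qpochS.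
transitivity ((qfall q 0 n * qfall q (-1) n * q ^+ n) * (q ^+ n * q * (1 + q ^+ n))).
  by rewrite (exprS q n); ring.
rewrite IH; have -> : q ^+ 'C(n.+2, 2) = q ^+ 'C(n.+1, 2) * (q ^+ n * q).
  by rewrite -exprSr -exprD binS bin1.
ring.
Qed.

(** The parameters are rho_1 = -1 and rho_2 = -q; the factors (-1;q^2)_n and (-q;q^2)_n combine into
    (-1;q)_(2n). *)
Lemma N2bar_weight n : rank_weight (q ^+ 2) (-1) (- q^-1) n = q ^+ n * qpoch (-1) q (2 * n).
Proof.
rewrite qpoch_split mulN1r /rank_weight; elim: n => [|n IH].
  by rewrite /qfall !big_ord0 !qpoch0 !mulr1.
rewrite !qfallS !qpochS; set w := (q ^+ 2) ^+ n.
transitivity ((qfall (q ^+ 2) (-1) n * qfall (q ^+ 2) (- q^-1) n * w) *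
    ((1 + w) * (- (- q^-1 * q ^+ 2) + w * q ^+ 2))).
  by rewrite (exprS (q ^+ 2) n) -/w; ring.
by rewrite IH q1V_mul (exprS q n); ring.
Qed.

Lemma v2P2 : vge 0 (2 * P2).
Proof. by apply: vgeMl => //; rewrite -[2]/(1 + 1); apply: vgeD; exact: vge1. Qed.

(** As bQ = -q, the factor (-q;q^2)_r of the weight cancels against the denominator, and the crank
    term is merely multiplied by q^(r^2). *)
Lemma N2_moment k : gf_pos (eta2 (2 * k.+1)) =
  P1 * sum_pos (fun n => (-1) ^+ (n + 1) * q ^+ (n * (2 * n - 1) + 2 * k.+1 * n) *
    (1 + q ^+ (2 * n)) / (1 - q ^+ (2 * n)) ^+ (2 * k.+1)).
Proof.
have v0 : vge 1 (0 * q ^+ 2) by rewrite mul0r; apply: vge0.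
have vb : vge 1 (- q^-1 * q ^+ 2) by rewrite q1V_mul.
have vab : vge 1 (0 * - q^-1 * q ^+ 2) by rewrite !mul0r; apply: vge0.
have vw n : vge n (rank_weight (q ^+ 2) 0 (- q^-1) n).
  rewrite N2_weight; apply: vgeMr; last by apply: vge_qpoch; apply: vgeW (leqnSn 0) _.
  by apply: vgeW (@vge_q1X _); nia.
have := rank_moment vq2 v0 vb vab vw k.
have -> : lsum setT (fun n => emb (rank_weight (q ^+ 2) 0 (- q^-1) n) *
    bailey_beta (emb (q ^+ 2)) z2 z2^-1 n) = N2_gf.
  apply: eq_lsum => n _.
  by rewrite N2_weight rmorphM /= emb_qpoch rmorphN !rmorphXn /= emb_q1.
move=> ->; rewrite (sum_posMl vP1) => [|n n1]; last by apply: vge_summand; [lia | nia | exact: vge0_q1D].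
apply: eq_lsum => r r1; rewrite N2_weight !mul0r q1V_mul qpoch_0l qpoch_inf_0l !mul1r mulr1.
rewrite mulrK; last by apply: qpoch_unit.
rewrite /crank_term -!exprM.
have -> : (r * (2 * r - 1) + 2 * k.+1 * r = r ^ 2 + 2 * ('C(r.+1, 2) + r * k))%N.
  by rewrite mulnDr two_bin2; nia.
by rewrite !(exprD q); set V := (1 - _) ^- _; ring.
Qed.

Lemma qpochN1S (Q : ser) n : qpoch (-1) Q n.+1 = 2 * qpoch (- Q) Q n.
Proof.
rewrite /qpoch big_ord_recl expr0; apply: (congr2 *%R); first by ring.
by apply: eq_bigr => i _; rewrite /= /bump /= add1n exprS; ring.
Qed.

(** The two factorials share all factors but the first of one and the last of the other. The
    quotient supplies the 2 in front of the overpartition rank identities and cancels 1 + Q^r in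
    [crank_term]. *)
Lemma qpochN1_ratio (Q : ser) n : vge 1 Q ->
  qpoch (-1) Q n.+1 / qpoch (- Q) Q n.+1 = 2 / (1 + Q ^+ n.+1).
Proof.
move=> vQ; have vNQ := vgeN vQ.
rewrite qpochN1S qpochS; have -> : 1 - - Q * Q ^+ n = 1 + Q ^+ n.+1 by rewrite exprS; ring.
have v : vge 1 (- (Q ^+ n.+1)) by rewrite exprS; exact: (vgeN (vgeW (ltn0Sn _) (vge_pow vQ vQ))).
rewrite divr_mul2r ?qpoch_unit //.
by rewrite -[Q ^+ _]opprK; exact: (unit_1B v).1.
Qed.

Lemma Nbar_moment k : gf_pos (eta_bar (2 * k.+1)) =
  2 * P2 * sum_pos (fun n => (-1) ^+ (n + 1) * q ^+ (n ^ 2 + k.+1 * n) /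
    (1 - q ^+ n) ^+ (2 * k.+1)).
Proof.
have v0 : vge 1 (0 * q) by rewrite mul0r; apply: vge0.
have vb : vge 1 (-1 * q) by rewrite mulN1r.
have vab : vge 1 (0 * -1 * q) by rewrite !mul0r; apply: vge0.
have vw n : vge n (rank_weight q 0 (-1) n).
  rewrite Nbar_weight; apply: vgeMl.
    by apply: vge_qpoch; [apply/vgeN/vge1 | apply: vgeW vq].
  by apply: vgeW (@vge_q1X _); apply: bin2_ge.
have := rank_moment vq v0 vb vab vw k.
have -> : lsum setT (fun n => emb (rank_weight q 0 (-1) n) *
    bailey_beta (emb q) z2 z2^-1 n) = Nbar_gf.
  apply: eq_lsum => n _.
  rewrite Nbar_weight rmorphM /= emb_qpoch rmorphN1 !rmorphXn /= emb_q1.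
  by rewrite -two_bin2 mulKn.
move=> ->; rewrite (sum_posMl v2P2) => [|n n1]; last first.
  by rewrite -[_ * q ^+ _]mulr1; apply: vge_summand; [lia | nia | exact: vge1].
apply: eq_lsum => -[//|r] _.
rewrite Nbar_weight !mul0r mulN1r qpoch_0l qpoch_inf_0l !mul1r mulr1.
have e : qpoch (-1) q r.+1 * q ^+ 'C(r.+2, 2) / qpoch (- q) q r.+1 =
    2 / (1 + q ^+ r.+1) * q ^+ 'C(r.+2, 2).
  by rewrite mulrAC (qpochN1_ratio r vq).
rewrite e /crank_term.
have [u _] := unit_q1D (ltn0Sn r).
(* The triangular exponent occurs twice, once from the weight and once from the crank term. *)
have -> : (r.+1 ^ 2 + k.+1 * r.+1 = 'C(r.+2, 2) + ('C(r.+2, 2) + r.+1 * k))%N.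
  by have := two_bin2 r.+1; nia.
rewrite !(exprD q) -[RHS]mulr1 -[X in _ = _ * X](mulrV u).
by set V := (1 - _) ^- _; set W := (1 + _)^-1; ring.
Qed.

Lemma N2bar_moment k : gf_pos (eta2_bar (2 * k.+1)) =
  2 * P2 * sum_pos (fun n => (-1) ^+ (n + 1) * q ^+ (n ^ 2 + 2 * k.+1 * n) /
    (1 - q ^+ (2 * n)) ^+ (2 * k.+1)).
Proof.
have va : vge 1 (-1 * q ^+ 2) by rewrite mulN1r; apply/vgeN.
have vb : vge 1 (- q^-1 * q ^+ 2) by rewrite q1V_mul.
have ab : -1 * - q^-1 * q ^+ 2 = q by rewrite -mulrA q1V_mul mulrNN mul1r.
have vab : vge 1 (-1 * - q^-1 * q ^+ 2) by rewrite ab.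
have vw n : vge n (rank_weight (q ^+ 2) (-1) (- q^-1) n).
  rewrite N2bar_weight; apply: vgeMr; first exact: vge_q1X.
  by apply: vge_qpoch; [apply/vgeN/vge1 | apply: vgeW vq].
have := rank_moment vq2 va vb vab vw k.
have -> : lsum setT (fun n => emb (rank_weight (q ^+ 2) (-1) (- q^-1) n) *
    bailey_beta (emb (q ^+ 2)) z2 z2^-1 n) = N2bar_gf.
  apply: eq_lsum => n _.
  by rewrite N2bar_weight rmorphM /= emb_qpoch rmorphN1 !rmorphXn /= emb_q1.
move=> ->; rewrite (sum_posMl v2P2) => [|n n1]; last first.
  by rewrite -[_ * q ^+ _]mulr1; apply: vge_summand; [lia | nia | exact: vge1].
apply: eq_lsum => -[//|r] _.
rewrite N2bar_weight ab q1V_mul mulN1r qpoch_split mulN1r.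
have vNq2 : vge 1 (- (q ^+ 2)) by apply/vgeN.
have e : q ^+ r.+1 * (qpoch (-1) (q ^+ 2) r.+1 * qpoch (- q) (q ^+ 2) r.+1) /
    (qpoch (- q ^+ 2) (q ^+ 2) r.+1 * qpoch (- q) (q ^+ 2) r.+1) =
    q ^+ r.+1 * (2 / (1 + (q ^+ 2) ^+ r.+1)).
  rewrite -(qpochN1_ratio r vq2) [X in _ / X]mulrC mulrA.
  by rewrite divr_mul2r ?qpoch_unit // mulrA.
rewrite e /crank_term.
(* Here abQ = q, so numerator and denominator are the even-odd splittings of (-q;q)_inf and
   (q;q)_inf. *)
have -> : qpoch_inf (- q ^+ 2) (q ^+ 2) * qpoch_inf (- q) (q ^+ 2) /
    (qpoch_inf (q ^+ 2) (q ^+ 2) * qpoch_inf q (q ^+ 2)) = P2.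
  rewrite (qpoch_inf_split vNq vq) (qpoch_inf_split vq vq) mulNr -expr2.
  by rewrite [X in X / _]mulrC [X in _ / X]mulrC.
have [u _] := unit_q1D (m := (2 * r.+1)%N) isT.
rewrite -!exprM.
have -> : (r.+1 ^ 2 + 2 * k.+1 * r.+1 = r.+1 + 2 * ('C(r.+2, 2) + r.+1 * k))%N.
  by rewrite mulnDr two_bin2; nia.
rewrite !(exprD q) -[RHS]mulr1 -[X in _ = _ * X](mulrV u).
by set V := (1 - _) ^- _; set W := (1 + _)^-1; ring.
Qed.

(** * Equality of the two forms of each sum *)

Section Fold.
Variable k : nat.

Lemma mul2kE (n : int) : k.+1%:Z * (2 * n) = 2 * k.+1%:Z * n.
Proof. by ring. Qed.

Lemma fold_crank2 :
  sum_nonzero (fun n : int => (-1) ^ (n + 1) * q ^ (n * (n + 1) + 2 * k.+1%:Z * n) /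
      (1 - q ^ (2 * n)) ^+ (2 * k.+1)) =
  sum_pos (fun n => (-1) ^+ (n + 1) * q ^+ (n * (n - 1) + 2 * k.+1 * n) *
    (1 + q ^+ (2 * n)) / (1 - q ^+ (2 * n)) ^+ (2 * k.+1)).
Proof.
have le_e n : (n <= n * (n - 1) + 2 * k.+1 * n)%N by nia.
rewrite -(fold_minus (E := fun n : int => n * (n + 1)) (isT : (0 < 2)%N) le_e).
- by apply: eq_lsum => n _; rewrite -mul2kE.
- by move=> n n0; nia.
- by move=> n n0; nia.
Qed.

Lemma fold_N2 :
  sum_nonzero (fun n : int => (-1) ^ (n + 1) * q ^ (n * (2 * n + 1) + 2 * k.+1%:Z * n) /
      (1 - q ^ (2 * n)) ^+ (2 * k.+1)) =
  sum_pos (fun n => (-1) ^+ (n + 1) * q ^+ (n * (2 * n - 1) + 2 * k.+1 * n) *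
    (1 + q ^+ (2 * n)) / (1 - q ^+ (2 * n)) ^+ (2 * k.+1)).
Proof.
have le_e n : (n <= n * (2 * n - 1) + 2 * k.+1 * n)%N by nia.
rewrite -(fold_minus (E := fun n : int => n * (2 * n + 1)) (isT : (0 < 2)%N) le_e).
- by apply: eq_lsum => n _; rewrite -mul2kE.
- by move=> n n0; nia.
- by move=> n n0; nia.
Qed.

Lemma fold_crank1 :
  sum_nonzero (fun n : int => (-1) ^ (n + 1) * q ^ (((n * (n + 1)) %/ 2)%Z + k.+1%:Z * n) /
      (1 - q ^ n) ^+ (2 * k.+1)) =
  sum_pos (fun n => (-1) ^+ (n + 1) * q ^+ ((n * (n - 1)) %/ 2 + k.+1 * n) *
    (1 + q ^+ n) / (1 - q ^+ n) ^+ (2 * k.+1)).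
Proof.
transitivity (sum_pos (fun n => (-1) ^+ (n + 1) * q ^+ ((n * (n - 1)) %/ 2 + k.+1 * n) *
    (1 + q ^+ (1 * n)) / (1 - q ^+ (1 * n)) ^+ (2 * k.+1))); last first.
  by apply: eq_lsum => n _; rewrite mul1n.
have half n : (n * (n - 1) %/ 2 = 'C(n, 2))%N by rewrite bin2 subn1 divn2.
have le_e n : (n <= n * (n - 1) %/ 2 + k.+1 * n)%N by nia.
rewrite -(fold_minus (E := fun n : int => ((n * (n + 1)) %/ 2)%Z) (isT : (0 < 1)%N) le_e).
- by apply: eq_lsum => n _; rewrite mul1r.
(* The integer quotient by 2 is exact, at n as well as at -n, once the product is written as twice a
   binomial coefficient. *)
- move=> n n0; have -> : n%:Z * (n%:Z + 1) = 'C(n.+1, 2)%:Z * 2 by have := two_bin2 n; nia.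
  by rewrite mulzK // half binS bin1; nia.
- move=> [//|n] _; have -> : - n.+1%:Z * (- n.+1%:Z + 1) = 'C(n.+1, 2)%:Z * 2 by have := two_bin2 n; nia.
  by rewrite mulzK // half; nia.
Qed.

Lemma fold_Nbar :
  sum_nonzero (fun n : int => (-1) ^ (n + 1) * q ^ (n ^+ 2 + n + k.+1%:Z * n) /
      ((1 + q ^ n) * (1 - q ^ n) ^+ (2 * k.+1))) =
  sum_pos (fun n => (-1) ^+ (n + 1) * q ^+ (n ^ 2 + k.+1 * n) / (1 - q ^+ n) ^+ (2 * k.+1)).
Proof.
transitivity (sum_pos (fun n => (-1) ^+ (n + 1) * q ^+ (n ^ 2 + k.+1 * n) /
   (1 - q ^+ (1 * n)) ^+ (2 * k.+1))); last first.
  by apply: eq_lsum => n _; rewrite mul1n.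
have le_e n : (n <= n ^ 2 + k.+1 * n)%N by nia.
rewrite -(fold_plus (E := fun n : int => n ^+ 2 + n) (isT : (0 < 1)%N) le_e).
- by apply: eq_lsum => n _; rewrite mul1r.
- by move=> n n0; nia.
- by move=> n n0; nia.
Qed.

Lemma fold_N2bar :
  sum_nonzero (fun n : int => (-1) ^ (n + 1) * q ^ (n ^+ 2 + 2 * n + 2 * k.+1%:Z * n) /
      ((1 + q ^ (2 * n)) * (1 - q ^ (2 * n)) ^+ (2 * k.+1))) =
  sum_pos (fun n => (-1) ^+ (n + 1) * q ^+ (n ^ 2 + 2 * k.+1 * n) /
    (1 - q ^+ (2 * n)) ^+ (2 * k.+1)).
Proof.
have le_e n : (n <= n ^ 2 + 2 * k.+1 * n)%N by nia.
rewrite -(fold_plus (E := fun n : int => n ^+ 2 + 2 * n) (isT : (0 < 2)%N) le_e).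
- by apply: eq_lsum => n _; rewrite -mul2kE.
- by move=> n n0; nia.
- by move=> n n0; nia.
Qed.
End Fold.
End Cases.

Theorem theorem2p1 (k : nat) (hk : (1 <= k)%N) :
  let q := q1 in
  let P1 := qpoch_inf (- q) (q ^+ 2) / qpoch_inf (q ^+ 2) (q ^+ 2) in
  let P2 := qpoch_inf (- q) q / qpoch_inf q q in
  [/\
    gf_pos (mu2 (2 * k)) =
      P1 * sum_nonzero (fun n => (-1) ^ (n + 1) *
             q ^ (n * (n + 1) + 2 * k%:Z * n) / (1 - q ^ (2 * n)) ^+ (2 * k))
    /\
    P1 * sum_nonzero (fun n => (-1) ^ (n + 1) *
             q ^ (n * (n + 1) + 2 * k%:Z * n) / (1 - q ^ (2 * n)) ^+ (2 * k)) =
      P1 * sum_pos (fun n => (-1) ^+ (n + 1) *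
             q ^+ (n * (n - 1) + 2 * k * n) * (1 + q ^+ (2 * n)) /
             (1 - q ^+ (2 * n)) ^+ (2 * k)),
    gf_pos (eta2 (2 * k)) =
      P1 * sum_nonzero (fun n => (-1) ^ (n + 1) *
             q ^ (n * (2 * n + 1) + 2 * k%:Z * n) / (1 - q ^ (2 * n)) ^+ (2 * k))
    /\
    P1 * sum_nonzero (fun n => (-1) ^ (n + 1) *
             q ^ (n * (2 * n + 1) + 2 * k%:Z * n) / (1 - q ^ (2 * n)) ^+ (2 * k)) =
      P1 * sum_pos (fun n => (-1) ^+ (n + 1) *
             q ^+ (n * (2 * n - 1) + 2 * k * n) * (1 + q ^+ (2 * n)) /
             (1 - q ^+ (2 * n)) ^+ (2 * k)),
    gf_pos (mu_bar (2 * k)) =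
      P2 * sum_nonzero (fun n => (-1) ^ (n + 1) *
             q ^ (((n * (n + 1)) %/ 2)%Z + k%:Z * n) / (1 - q ^ n) ^+ (2 * k))
    /\
    P2 * sum_nonzero (fun n => (-1) ^ (n + 1) *
             q ^ (((n * (n + 1)) %/ 2)%Z + k%:Z * n) / (1 - q ^ n) ^+ (2 * k)) =
      P2 * sum_pos (fun n => (-1) ^+ (n + 1) *
             q ^+ ((n * (n - 1)) %/ 2 + k * n) * (1 + q ^+ n) /
             (1 - q ^+ n) ^+ (2 * k)) &
    [/\
    gf_pos (eta_bar (2 * k)) =
      2 * P2 * sum_nonzero (fun n => (-1) ^ (n + 1) *
             q ^ (n ^+ 2 + n + k%:Z * n) /
             ((1 + q ^ n) * (1 - q ^ n) ^+ (2 * k)))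
    /\
    2 * P2 * sum_nonzero (fun n => (-1) ^ (n + 1) *
             q ^ (n ^+ 2 + n + k%:Z * n) /
             ((1 + q ^ n) * (1 - q ^ n) ^+ (2 * k))) =
      2 * P2 * sum_pos (fun n => (-1) ^+ (n + 1) *
             q ^+ (n ^ 2 + k * n) / (1 - q ^+ n) ^+ (2 * k)),
    gf_pos (mu2_bar (2 * k)) =
      P2 * sum_nonzero (fun n => (-1) ^ (n + 1) *
             q ^ (n * (n + 1) + 2 * k%:Z * n) / (1 - q ^ (2 * n)) ^+ (2 * k))
    /\
    P2 * sum_nonzero (fun n => (-1) ^ (n + 1) *
             q ^ (n * (n + 1) + 2 * k%:Z * n) / (1 - q ^ (2 * n)) ^+ (2 * k)) =
      P2 * sum_pos (fun n => (-1) ^+ (n + 1) *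
             q ^+ (n * (n - 1) + 2 * k * n) * (1 + q ^+ (2 * n)) /
             (1 - q ^+ (2 * n)) ^+ (2 * k)) &
    gf_pos (eta2_bar (2 * k)) =
      2 * P2 * sum_nonzero (fun n => (-1) ^ (n + 1) *
             q ^ (n ^+ 2 + 2 * n + 2 * k%:Z * n) /
             ((1 + q ^ (2 * n)) * (1 - q ^ (2 * n)) ^+ (2 * k)))
    /\
    2 * P2 * sum_nonzero (fun n => (-1) ^ (n + 1) *
             q ^ (n ^+ 2 + 2 * n + 2 * k%:Z * n) /
             ((1 + q ^ (2 * n)) * (1 - q ^ (2 * n)) ^+ (2 * k))) =
      2 * P2 * sum_pos (fun n => (-1) ^+ (n + 1) *
             q ^+ (n ^ 2 + 2 * k * n) / (1 - q ^+ (2 * n)) ^+ (2 * k))]].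
Proof.
case: k hk => [//|k] _ q P1 P2.
split; [| | |split]; split.
- by rewrite (fold_crank2 k); exact: M2_moment.
- by rewrite (fold_crank2 k).
- by rewrite (fold_N2 k); exact: N2_moment.
- by rewrite (fold_N2 k).
- by rewrite (fold_crank1 k); exact: Mbar_moment.
- by rewrite (fold_crank1 k).
- by rewrite (fold_Nbar k); exact: Nbar_moment.
- by rewrite (fold_Nbar k).
- by rewrite (fold_crank2 k); exact: M2bar_moment.
- by rewrite (fold_crank2 k).
- by rewrite (fold_N2bar k); exact: N2bar_moment.
- by rewrite (fold_N2bar k).
Qed.
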